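(* Let $D$ be the combinatorial type of a fan of $\mathbb{R}^d$ which has a simplicial cone of maximal dimension $d$ (labelled so that $\{1,\dots,d\}\in D$ is such a cone), let $n\ge \mathrm{Card}(D(1))$ and let $\mathcal{I}\subset\{1,\dots,n\}\setminus D(1)$. Put $J:=\{1,\dots,n\}\setminus(D(1)\cup\mathcal{I})$. Then the moduli stack $\mathscr{M}(d,n,D,\mathcal{I})$ of quantum toric stacks given by fans of combinatorial type $D$ with virtual generators $\mathcal{I}$ is isomorphic to the quotient stack $$\left[\Omega(D)\,/\,\mathrm{Aut}_{\mathbf{Poset}}(D)\times(\mathbb{Z}^{D(1)})^J\times \mathrm{GL}_J(\mathbb{Z})\times\mathfrak{S}_{\mathcal{I}}\right],$$ where the action on $\Omega(D)$ is as follows. For $h\in\Omega(D)$, $\tau\in\mathrm{Aut}_{\mathbf{Poset}}(D)$, $(\alpha_j)_{j\in J}\in(\mathbb{Z}^{D(1)})^J$, $A\in\mathrm{GL}_J(\mathbb{Z})$, $\sigma\in\mathfrak{S}_{\mathcal{I}}$, set (in block form with respect to $\mathbb{Z}^n=\mathbb{Z}^{D(1)}\oplus\mathbb{Z}^J\oplus\mathbb{Z}^{\mathcal{I}}$) $$H=\begin{pmatrix}P_\tau&(\alpha_j)_{j\in J}&0\\0&A&0\\0&0&P_\sigma\end{pmatrix},\qquad L=\big(h(e_{\tau^{-1}(1)})\ \cdots\ h(e_{\tau^{-1}(d)})\big)^{-1};$$ then $(\tau,(\alpha_j)_{j\in J},A,\sigma)\cdot h=LhH^{-1}$. (The group structure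 on the set $\mathrm{Aut}_{\mathbf{Poset}}(D)\times(\mathbb{Z}^{D(1)})^J\times \mathrm{GL}_J(\mathbb{Z})\times\mathfrak{S}_{\mathcal{I}}$ is that of multiplication of the matrices $H$.)
   Context: A quantum fan in a finitely generated subgroup $\Gamma\subset\mathbb{R}^d$ spanning $\mathbb{R}^d$ is a triple $(\Delta,h:\mathbb{Z}^n\to\Gamma,\mathcal{I})$ where: $\Delta$ is a finite collection of strongly convex polyhedral cones generated by elements of $\Gamma$, stable under faces and intersections (intersections being common faces) and containing $\{0\}$; $h$ is a group epimorphism (calibration) with $h(e_i)=e_i$ for $1\le i\le d$; $\mathcal{I}\subset\{1,\dots,n\}$ is the set of virtual generators (the $h(e_j)$, $j\notin \mathcal I$, span); and the rays of $\Delta$ are exactly generated by $h(e_i)$, $i\in A$, for a given set of generators $A\subset\{1,\dots,n\}\setminus\mathcal{I}$. A morphism of quantum fans is a pair of linear maps $(L,H)$, $L:\mathbb{R}^d\to\mathbb{R}^d$, $H:\mathbb{R}^n\to\mathbb{R}^{n}$ (with $H$ integral), compatible with the calibrations ($Lh=h'H$), with inclusion of cones, and with virtual generators (isomorphisms send generators of rays to generators of rays and permute the virtual generators). The combinatorial type $\mathrm{comb}(\Delta)$ is the poset (under inclusion) of subsets $I\subset\{1,\dots,n\}$ of generators such that $\mathrm{Cone}(h(e_i),i\in I)\in\Delta$. For a combinatorial type $D$, $D(1)$ is the set of its rays (indices $i$ with $\{i\}\in D$). A calibration $(h,\mathcal{I})$ is $D$-admissible if the cones $\mathrm{Cone}(h(e_i),i\in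 I)$, $I\in D$, form (with $h,\mathcal I$) a quantum fan of combinatorial type $D$; the fan is determined by $(D,h,\mathcal{I})$. $\mathscr{M}(d,n,D,\mathcal{I})$ is the stack (over the site of real manifolds with Euclidean coverings) $\{h:\mathbb{Z}^n\to\mathbb{R}^d\mid (h,\mathcal I)\ D\text{-admissible}\}/\simeq$, i.e. the stackification of the groupoid describing the relation $h\simeq h'$ given by isomorphisms between the fan of $(D,h,\mathcal{I})$ and the fan of $(D,h',\mathcal{I})$ (here $h$ need not satisfy $h(e_i)=e_i$). $\Omega(D)\subset\mathbb{R}^{d(n-d)}=(\mathbb{R}^d)^{n-d}$ is the set of $(h(e_{d+1}),\dots,h(e_n))$ for $D$-admissible $h:\mathbb{Z}^n\to\mathbb{R}^d$ with $h(e_i)=e_i$ for $1\le i\le d$. $\mathrm{Aut}_{\mathbf{Poset}}(D)$ is the group of automorphisms of the poset $D$, regarded as a group of permutations of $D(1)$. $\mathfrak{S}_{\mathcal{I}}$ is the group of bijections of $\mathcal{I}$. $P_\sigma=(\delta_{i,\sigma(j)})_{i,j}$ is the permutation matrix of $\sigma$ ($P_\sigma e_j=e_{\sigma(j)}$). *)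

(* Defs.v *)
From HB Require Import structures.
From mathcomp Require Import all_boot all_order all_algebra all_fingroup.
From mathcomp Require Import all_classical all_reals all_analysis.

Set Implicit Arguments.
Unset Strict Implicit.
Unset Printing Implicit Defensive.

Import Order.TTheory GRing.Theory Num.Theory.
Import numFieldNormedType.Exports.

Local Open Scope classical_set_scope.
Local Open Scope ring_scope.

Lemma near_eq_diff (K : numFieldType) (E W : normedModType K) (f g : E -> W) (x : E) :
  (\forall y \near x, f y = g y) -> differentiable f x ->
  differentiable g x /\ 'd g x = 'd f x :> (E -> W).
Proof.
move=> fg /diff_locallyP[cdf fE].
have gE : g \o shift x = cst (g x) + 'd f x +o_ (0 : E) id.
  move/eqaddoP : fE => fE; apply/eqaddoP => e e0.
  have nr : \forall h \near (0 : E), f (h + x) = g (h + x).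
    by have := fg; rewrite (near_shift 0) /= subr0.
  near=> h.
  have <- : (f \o shift x - (cst (f x) + 'd f x)) h =
            (g \o shift x - (cst (g x) + 'd f x)) h.
    rewrite !fctE /= (nbhs_singleton fg); congr (_ - _).
    by near: h.
  by near: h; exact: fE.
have dE := diff_unique cdf gE; split=> //.
by apply/diff_locallyP; rewrite dE.
Unshelve. all: by end_near. Qed.

Section Smooth.
Context {K : numFieldType} {E : normedModType K}.
Implicit Types (U : set E) (f g : E -> K).

Fixpoint Cr_on (r : nat) U g : Prop :=
  match r with
  | 0%N => forall x, U x -> {for x, continuous g}
  | s.+1 => (forall x, U x -> differentiable g x) /\
            (forall v, Cr_on s U (fun x => 'd g x v))
  end.

Definition smooth_germ (p : E) g : Prop :=
  exists2 U, open_nbhs p U & forall r, Cr_on r U g.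

Lemma Cr_on_sub r U V g : V `<=` U -> Cr_on r U g -> Cr_on r V g.
Proof.
move=> VU; elim: r g => [|r IH] g /=; first by move=> h x /VU/h.
by move=> [h1 h2]; split=> [x /VU/h1|v]; last exact/IH/h2.
Qed.

Lemma Cr_onS r U g : Cr_on r.+1 U g -> Cr_on r U g.
Proof.
elim: r g => [|r IH] g /= [h1 h2].
  by move=> x /h1; exact: differentiable_continuous.
by split=> // v; apply: IH; exact: h2.
Qed.

Lemma Cr_on_ext r U f g : open U -> (forall x, U x -> f x = g x) ->
  Cr_on r U f -> Cr_on r U g.
Proof.
move=> oU; elim: r f g => [|r IH] f g e.
  move=> h x Ux.
  have n : \forall y \near x, f y = g y.
    by apply: filterS (open_nbhs_nbhs (conj oU Ux)) => y /e.
  have := h _ Ux; rewrite /prop_for /continuous_at (e _ Ux).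
  by move=> c; apply: (cvg_trans _ c); apply: (@near_eq_cvg _ _ (nbhs x)).
have key x : U x -> differentiable f x ->
    differentiable g x /\ 'd g x = 'd f x :> (E -> K).
  move=> Ux; apply: near_eq_diff.
  by apply: filterS (open_nbhs_nbhs (conj oU Ux)) => y /e.
move=> [h1 h2]; split=> [x Ux|v]; first by case: (key x Ux (h1 _ Ux)).
apply: IH (h2 v) => x Ux.
by case: (key x Ux (h1 _ Ux)) => _ ->.
Qed.

Lemma Cr_on_cst r U c : Cr_on r U (fun=> c).
Proof.
elim: r c => [|r IH] c /=; first by move=> x _; exact: cst_continuous.
split=> [x _|v]; first exact: differentiable_cst.
rewrite (_ : (fun _ => _) = (fun=> 0)); first exact: IH.
by apply/funext => x; rewrite (diff_cst _ x).
Qed.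

Lemma Cr_onD r U f g : open U ->
  Cr_on r U f -> Cr_on r U g -> Cr_on r U (fun x => f x + g x).
Proof.
move=> oU; elim: r f g => [|r IH] f g.
  by move=> hf hg x Ux; apply: continuousD; [exact: hf|exact: hg].
move=> [f1 f2] [g1 g2]; split=> [x Ux|v].
  by apply: differentiableD; [exact: f1|exact: g1].
apply: Cr_on_ext (IH _ _ (f2 v) (g2 v)) => // x Ux.
by rewrite (diffD (f1 _ Ux) (g1 _ Ux)).
Qed.

Lemma Cr_onM r U f g : open U ->
  Cr_on r U f -> Cr_on r U g -> Cr_on r U (fun x => f x * g x).
Proof.
move=> oU; elim: r f g => [|r IH] f g.
  by move=> hf hg x Ux; apply: continuousM; [exact: hf|exact: hg].
move=> hf hg; have [f1 f2] := hf; have [g1 g2] := hg; split=> [x Ux|v].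
  by apply: differentiableM; [exact: f1|exact: g1].
have h1 := IH _ _ (Cr_onS hf) (g2 v).
have h2 := IH _ _ (Cr_onS hg) (f2 v).
apply: Cr_on_ext (Cr_onD oU h1 h2) => // x Ux.
by rewrite (diffM (f1 _ Ux) (g1 _ Ux)).
Qed.

Lemma smooth_germ_cst p c : smooth_germ p (fun=> c).
Proof. by exists setT; [split=> //; exact: openT|move=> r; exact: Cr_on_cst]. Qed.

Let smooth_germ2 op p f g :
  (forall r U f g, open U -> Cr_on r U f -> Cr_on r U g ->
    Cr_on r U (fun x => op (f x) (g x))) ->
  smooth_germ p f -> smooth_germ p g -> smooth_germ p (fun x => op (f x) (g x)).
Proof.
move=> H [U [oU Up] hf] [V [oV Vp] hg]; have oUV := openI oU oV.
exists (U `&` V); first by split.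
move=> r; apply: H => //.
  by apply: Cr_on_sub (hf r) => x [].
by apply: Cr_on_sub (hg r) => x [].
Qed.

Lemma smooth_germD p f g :
  smooth_germ p f -> smooth_germ p g -> smooth_germ p (fun x => f x + g x).
Proof. by apply: smooth_germ2 => *; exact: Cr_onD. Qed.

Lemma smooth_germM p f g :
  smooth_germ p f -> smooth_germ p g -> smooth_germ p (fun x => f x * g x).
Proof. by apply: smooth_germ2 => *; exact: Cr_onM. Qed.

End Smooth.

(* Smooth (second countable Hausdorff) manifolds, as spaces carrying a sheaf of
   real functions locally isomorphic to the sheaf of C^oo functions on R^k; the
   sheaf is recorded by its germs: [smooth_at x f] says that f is a section of
   it on some neighbourhood of x.  A chart [phi] is an open embedding of [U]. *)
Record manifold (R : realType) := Manifold {
  mspace :> topologicalType;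
  mdim : nat;
  smooth_at : mspace -> (mspace -> R) -> Prop;
  manifold_hausdorff : hausdorff_space mspace;
  manifold_second_countable : @second_countable mspace;
  smooth_at_local : forall x f g, (\forall y \near x, f y = g y) ->
    smooth_at x f -> smooth_at x g;
  manifold_chart : forall x, exists U (phi : mspace -> 'rV[R]_mdim),
    [/\ open_nbhs x U,
        forall y z, U y -> U z -> phi y = phi z -> y = z,
        forall y, U y -> {for y, continuous phi},
        forall V, open V -> V `<=` U -> open (phi @` V) &
        forall y g, U y -> (smooth_at y (g \o phi) <-> smooth_germ (phi y) g)] }.

Arguments smooth_at {R m}.

Section Manifolds.
Context {R : realType}.
Implicit Types S T U V W : manifold R.

Definition smooth_map S T (f : S -> T) : Prop :=
  continuous f /\ forall x g, smooth_at (f x) g -> smooth_at x (g \o f).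

Record smap S T := Smap { smap_fun :> S -> T; smapP : smooth_map smap_fun }.

Lemma smap_eq S T (f g : smap S T) : smap_fun f = smap_fun g -> f = g.
Proof.
by case: f g => f p [g q] /= e; case: _ / e q => q; congr Smap; exact: Prop_irrelevance.
Qed.

Lemma smooth_map_id S : smooth_map (@id S).
Proof. by split=> // x; exact: cvg_id. Qed.

Lemma smooth_map_comp S T U (g : smap T U) (f : smap S T) : smooth_map (g \o f).
Proof.
case: g f => g [cg sg] [f [cf sf]] /=; split=> [x|x u /sg/sf//].
by apply: continuous_comp; [exact: cf|exact: cg].
Qed.

Definition sid S : smap S S := Smap (@smooth_map_id S).
Definition scomp S T U (g : smap T U) (f : smap S T) : smap S U :=
  Smap (smooth_map_comp g f).

Definition open_embedding U T (u : smap U T) : Prop :=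
  [/\ injective u,
      forall V : set U, open V -> open (u @` V) &
      forall x g, smooth_at x (g \o u) <-> smooth_at (u x) g].

Record sieve T := Sieve {
  sieve_mem :> forall V, smap V T -> Prop;
  sieve_comp : forall V W (f : smap V T) (g : smap W V),
    sieve_mem f -> sieve_mem (scomp f g) }.

End Manifolds.

(* The Grothendieck topology of open (Euclidean) coverings. *)
Definition covering (R : realType) (T : manifold R) (S : sieve T) : Prop :=
  forall t : T, exists (U : manifold R) (u : smap U T),
    [/\ open_embedding u, S U u & range u t].

(* Categories over the category of manifolds: [fob T] is the collection of
   objects lying over T and [fover a] is the smooth map below an arrow [a]. *)
Record catover (R : realType) := CatOver {
  fob : manifold R -> Type;
  fhom : forall S T, fob S -> fob T -> Type;
  fover : forall S T (x : fob S) (y : fob T), fhom x y -> smap S T;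
  fid : forall T (x : fob T), fhom x x;
  fcomp : forall S T U (x : fob S) (y : fob T) (z : fob U),
    fhom y z -> fhom x y -> fhom x z;
  fcomp_idl : forall S T (x : fob S) (y : fob T) (a : fhom x y),
    fcomp (fid y) a = a;
  fcomp_idr : forall S T (x : fob S) (y : fob T) (a : fhom x y),
    fcomp a (fid x) = a;
  fcompA : forall S T U V (x : fob S) (y : fob T) (z : fob U) (w : fob V)
    (c : fhom z w) (b : fhom y z) (a : fhom x y),
    fcomp c (fcomp b a) = fcomp (fcomp c b) a;
  fover_id : forall T (x : fob T), fover (fid x) = sid T;
  fover_comp : forall S T U (x : fob S) (y : fob T) (z : fob U)
    (b : fhom y z) (a : fhom x y), fover (fcomp b a) = scomp (fover b) (fover a) }.

Arguments fhom {R} _ {S T} _ _.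
Arguments fid {R} _ {T} _.

Section Stacks.
Context {R : realType}.
Implicit Types (X Y Z : catover R) (S T U V W : manifold R).

Definition fibred_in_groupoids X : Prop :=
  (forall S T (f : smap S T) (y : fob X T),
     exists (x : fob X S) (a : fhom X x y), fover a = f) /\
  (forall S T U (x : fob X S) (y : fob X T) (z : fob X U)
     (b : fhom X y z) (c : fhom X x z) (f : smap S T),
     scomp (fover b) f = fover c ->
     exists! a : fhom X x y, fover a = f /\ fcomp b a = c).

(* Gluing of arrows and descent data are expressed on covering sieves, so that no
   fibre products U_i x_T U_j are needed. *)
Definition arrows_glue X : Prop :=
  forall T (S : sieve T), covering S -> forall (x y : fob X T)
    (b : forall V (z : fob X V) (a : fhom X z x), S V (fover a) -> fhom X z y),
  (forall V (z : fob X V) (a : fhom X z x) (Sa : S V (fover a)),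
     fover (b V z a Sa) = fover a) ->
  (forall V W (z : fob X V) (w : fob X W) (a : fhom X z x) (c : fhom X w z)
     (Sa : S V (fover a)) (Sac : S W (fover (fcomp a c))),
     b W w (fcomp a c) Sac = fcomp (b V z a Sa) c) ->
  exists! e : fhom X x y, fover e = sid T /\
    forall V (z : fob X V) (a : fhom X z x) (Sa : S V (fover a)),
      fcomp e a = b V z a Sa.

Record descent_datum X T (S : sieve T) := DescentDatum {
  dd_ob : forall V (f : smap V T), S V f -> fob X V;
  dd_hom : forall V W (f : smap V T) (f' : smap W T) (Sf : S V f) (Sf' : S W f')
    (g : smap W V), scomp f g = f' -> fhom X (dd_ob Sf') (dd_ob Sf);
  dd_over : forall V W (f : smap V T) (f' : smap W T) (Sf : S V f)
    (Sf' : S W f') (g : smap W V) (e : scomp f g = f'),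
    fover (dd_hom Sf Sf' e) = g;
  dd_cocycle : forall U V W (f : smap U T) (f' : smap V T) (f'' : smap W T)
    (Sf : S U f) (Sf' : S V f') (Sf'' : S W f'') (g : smap V U) (g' : smap W V)
    (e : scomp f g = f') (e' : scomp f' g' = f'')
    (e'' : scomp f (scomp g g') = f''),
    fcomp (dd_hom Sf Sf' e) (dd_hom Sf' Sf'' e') = dd_hom Sf Sf'' e'' }.

Definition effective X T (S : sieve T) (x : descent_datum X S) : Prop :=
  exists (y : fob X T) (a : forall V (f : smap V T) (Sf : S V f),
      fhom X (dd_ob x Sf) y),
    (forall V (f : smap V T) (Sf : S V f), fover (a V f Sf) = f) /\
    (forall V W (f : smap V T) (f' : smap W T) (Sf : S V f) (Sf' : S W f')
       (g : smap W V) (e : scomp f g = f'),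
       fcomp (a V f Sf) (dd_hom x Sf Sf' e) = a W f' Sf').

Definition is_stack X : Prop :=
  [/\ fibred_in_groupoids X, arrows_glue X &
      forall T (S : sieve T), covering S ->
        forall x : descent_datum X S, effective x].

Record funover X Y := FunOver {
  fun_ob :> forall T, fob X T -> fob Y T;
  fun_hom : forall S T (x : fob X S) (y : fob X T),
    fhom X x y -> fhom Y (fun_ob x) (fun_ob y);
  fun_id : forall T (x : fob X T), fun_hom (fid X x) = fid Y (fun_ob x);
  fun_comp : forall S T U (x : fob X S) (y : fob X T) (z : fob X U)
    (b : fhom X y z) (a : fhom X x y),
    fun_hom (fcomp b a) = fcomp (fun_hom b) (fun_hom a);
  fun_over : forall S T (x : fob X S) (y : fob X T) (a : fhom X x y),
    fover (fun_hom a) = fover a }.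

Definition idfun_over X : funover X X.
Proof. by exists (fun T x => x) (fun S T x y a => a). Defined.

Definition compfun_over X Y Z (G : funover Y Z) (F : funover X Y) : funover X Z.
Proof.
exists (fun T x => G T (F T x)) (fun S T x y a => fun_hom G (fun_hom F a)).
- by move=> T x; rewrite !fun_id.
- by move=> S T U x y z b a; rewrite !fun_comp.
- by move=> S T x y a; rewrite !fun_over.
Defined.

Record nat_over X Y (F G : funover X Y) := NatOver {
  nat_hom :> forall T (x : fob X T), fhom Y (F T x) (G T x);
  nat_over_id : forall T (x : fob X T), fover (nat_hom x) = sid T;
  nat_natural : forall S T (x : fob X S) (y : fob X T) (a : fhom X x y),
    fcomp (nat_hom y) (fun_hom F a) = fcomp (fun_hom G a) (nat_hom x) }.

Definition iso_over X Y (F G : funover X Y) : Prop :=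
  exists (a : nat_over F G) (b : nat_over G F), forall T (x : fob X T),
    fcomp (b T x) (a T x) = fid Y (F T x) /\
    fcomp (a T x) (b T x) = fid Y (G T x).

Definition stack_iso X Y : Prop :=
  exists (F : funover X Y) (G : funover Y X),
    iso_over (compfun_over G F) (idfun_over X) /\
    iso_over (compfun_over F G) (idfun_over Y).

(* M is the stack associated with X: for every stack Y, composition with
   [i : X -> M] is an equivalence between the categories of morphisms M -> Y and
   X -> Y; this determines M up to an equivalence. *)
Definition is_stackification X M : Prop :=
  is_stack M /\ exists i : funover X M, forall Y, is_stack Y ->
    (forall F : funover X Y,
       exists F' : funover M Y, iso_over (compfun_over F' i) F) /\
    (forall (F G : funover M Y)
       (b : nat_over (compfun_over F i) (compfun_over G i)),
       exists a : nat_over F G, (forall T (x : fob X T), a T (i T x) = b T x) /\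
         forall a' : nat_over F G, (forall T (x : fob X T), a' T (i T x) = b T x) ->
           forall T (y : fob M T), a' T y = a T y).

End Stacks.

Section QuantumFans.
Context {R : realType}.

Definition intmx p q (A : 'M[int]_(p, q)) : 'M[R]_(p, q) := map_mx intr A.

Definition cone d n (h : 'M[R]_(d, n)) (I : {set 'I_n}) : set 'cV[R]_d :=
  [set x | exists a : 'I_n -> R,
    (forall i, 0 <= a i) /\ x = \sum_(i in I) a i *: col i h].

Definition is_face d (s t : set 'cV[R]_d) : Prop :=
  exists u : 'rV[R]_d, (forall x, s x -> 0 <= (u *m x) 0 0) /\
    t = [set x | s x /\ (u *m x) 0 0 = 0].

Definition is_ray d (s : set 'cV[R]_d) : Prop :=
  exists2 v : 'cV[R]_d, v != 0 & s = [set x | exists2 a : R, 0 <= a & x = a *: v].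

Definition spanning d n (h : 'M[R]_(d, n)) (I : {set 'I_n}) : Prop :=
  forall x : 'cV[R]_d, exists a : 'I_n -> R, x = \sum_(i in I) a i *: col i h.

(* [qf_calib] is the matrix of the calibration h : Z^n -> R^d, whose columns are
   the h(e_i), and Gamma is the image of h.  No normalization h(e_i) = e_i is
   included. *)
Record quantum_fan (d n : nat) := QuantumFan {
  qf_cones : set (set 'cV[R]_d);
  qf_calib : 'M[R]_(d, n);
  qf_virt : {set 'I_n};
  qf_gens : {set 'I_n} }.

Record is_quantum_fan d n (F : quantum_fan d n) : Prop := IsQuantumFan {
  qf_finite : finite_set (qf_cones F);
  qf_polyhedral : forall s, qf_cones F s -> exists k (g : 'M[int]_(n, k)),
        s = cone (qf_calib F *m intmx g) [set: 'I_k]%SET;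
  qf_strongly_convex : forall s, qf_cones F s -> forall x, s x -> s (- x) -> x = 0;
  qf_zero : qf_cones F [set 0];
  qf_face : forall s t, qf_cones F s -> is_face s t -> qf_cones F t;
  qf_inter : forall s t, qf_cones F s -> qf_cones F t ->
        is_face s (s `&` t) /\ is_face t (s `&` t);
  qf_span : spanning (qf_calib F) [set: 'I_n]%SET;
  qf_virt_span : spanning (qf_calib F) (~: qf_virt F)%SET;
  qf_gens_nonvirt : qf_gens F \subset (~: qf_virt F)%SET;
  qf_gens_ray : forall i, i \in qf_gens F ->
        qf_cones F (cone (qf_calib F) [set i]%SET) /\
        is_ray (cone (qf_calib F) [set i]%SET);
  qf_gens_inj : forall i j, i \in qf_gens F -> j \in qf_gens F ->
        cone (qf_calib F) [set i]%SET = cone (qf_calib F) [set j]%SET -> i = j;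
  qf_ray_gens : forall s, qf_cones F s -> is_ray s ->
        exists2 i, i \in qf_gens F & s = cone (qf_calib F) [set i]%SET }.

Definition comb d n (F : quantum_fan d n) : {set {set 'I_n}} :=
  [set I : {set 'I_n} | (I \subset qf_gens F) &&
                        `[< qf_cones F (cone (qf_calib F) I) >]]%SET.

Record quantum_fan_mor d n d' n' (F : quantum_fan d n) (F' : quantum_fan d' n')
    (L : 'M[R]_(d', d)) (H : 'M[int]_(n', n)) : Prop := QuantumFanMor {
  mor_calib : L *m qf_calib F = qf_calib F' *m intmx H;
  mor_cones : forall s, qf_cones F s -> exists2 s', qf_cones F' s' &
    forall x, s x -> s' (L *m x);
  (* compatibility with virtual generators: virtual generators are sent to sums
     of virtual generators, and the subgroup spanned by the non-virtual e_j to the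
     subgroup spanned by the non-virtual ones *)
  mor_virt : forall i, i \in qf_virt F -> forall k,
    0 <= H k i /\ (k \notin qf_virt F' -> H k i = 0);
  mor_nonvirt : forall j, j \notin qf_virt F -> forall k,
    k \in qf_virt F' -> H k j = 0 }.

Definition maps_generators n (H : 'M[int]_n) (A A' : {set 'I_n}) : Prop :=
  forall i, i \in A -> exists2 k, k \in A' & col i H = delta_mx k 0.

Definition quantum_fan_iso_half d n (F F' : quantum_fan d n)
    (L : 'M[R]_d) (H : 'M[int]_n) : Prop :=
  [/\ quantum_fan_mor F F' L H,
      maps_generators H (qf_gens F) (qf_gens F') &
      maps_generators H (qf_virt F) (qf_virt F')].

Definition quantum_fan_iso d n (F F' : quantum_fan d n)
    (L : 'M[R]_d) (H : 'M[int]_n) : Prop :=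
  [/\ L \in unitmx, H \in unitmx, quantum_fan_iso_half F F' L H &
      quantum_fan_iso_half F' F (invmx L) (invmx H)].

Definition rays n (D : {set {set 'I_n}}) : {set 'I_n} :=
  [set i | [set i]%SET \in D]%SET.

Definition fan_of d n (D : {set {set 'I_n}}) (I : {set 'I_n})
    (h : 'M[R]_(d, n)) : quantum_fan d n :=
  QuantumFan [set s | exists2 K, K \in D & s = cone h K] h I (rays D).

Definition admissible d n (D : {set {set 'I_n}}) (I : {set 'I_n})
    (h : 'M[R]_(d, n)) : Prop :=
  is_quantum_fan (fan_of D I h) /\ comb (fan_of D I h) = D.

(* Omega(D), for n = d + m; w is the matrix with columns h(e_{d+1}),...,h(e_n) *)
Definition Omega d m (D : {set {set 'I_(d + m)}}) (I : {set 'I_(d + m)}) :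
    set 'M[R]_(d, m) :=
  [set w | admissible D I (row_mx 1%:M w)].

Lemma intmxM p q r (A : 'M[int]_(p, q)) (B : 'M[int]_(q, r)) :
  intmx (A *m B) = intmx A *m intmx B.
Proof. exact: map_mxM. Qed.

Lemma intmx1 n : intmx (1%:M : 'M[int]_n) = 1%:M.
Proof. by rewrite /intmx map_scalar_mx. Qed.

Lemma invmxM (K : comUnitRingType) n (A B : 'M[K]_n) :
  A \in unitmx -> B \in unitmx -> invmx (A *m B) = invmx B *m invmx A.
Proof.
move=> uA uB; have uAB : A *m B \in unitmx by rewrite unitmx_mul uA.
apply: (can_inj (mulKmx uAB)); rewrite mulmxV // mulmxA -(mulmxA A) mulmxV //.
by rewrite mulmx1 mulmxV.
Qed.

Lemma colM_delta (K : pzRingType) p q r (A : 'M[K]_(p, q)) (B : 'M[K]_(q, r)) i k :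
  col i B = delta_mx k 0 -> col i (A *m B) = col k A.
Proof. by move=> e; rewrite colE -mulmxA -colE e -colE. Qed.

Lemma quantum_fan_mor_id d n (F : quantum_fan d n) :
  quantum_fan_mor F F 1%:M 1%:M.
Proof.
split.
- by rewrite intmx1 mul1mx mulmx1.
- by move=> s Fs; exists s => // x; rewrite mul1mx.
- move=> i iv k; rewrite mxE; split; first by case: eqP.
  by case: eqP => // ->; rewrite iv.
- by move=> j jv k kv; rewrite mxE; case: eqP => // e; rewrite -e kv in jv.
Qed.

Lemma quantum_fan_mor_comp d n d' n' d'' n'' (F : quantum_fan d n)
    (F' : quantum_fan d' n') (F'' : quantum_fan d'' n'') L H L' H' :
  quantum_fan_mor F F' L H -> quantum_fan_mor F' F'' L' H' ->
  quantum_fan_mor F F'' (L' *m L) (H' *m H).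
Proof.
move=> [c1 k1 v1 w1] [c2 k2 v2 w2]; split.
- by rewrite -mulmxA c1 mulmxA c2 -mulmxA intmxM.
- move=> s /k1[s' /k2[s'' Fs'' h2] h1]; exists s'' => // x /h1/h2.
  by rewrite mulmxA.
- move=> i iv k; rewrite mxE; split.
    apply: sumr_ge0 => j _; have [H0 Hz] := v1 i iv j.
    have [jv|jv] := boolP (j \in qf_virt F'); last by rewrite Hz // mulr0.
    by apply: mulr_ge0 => //; case: (v2 j jv k).
  move=> kv; apply: big1 => j _.
  have [jv|jv] := boolP (j \in qf_virt F').
    by have [_ /(_ kv)->] := v2 j jv k; rewrite mul0r.
  by have [_ /(_ jv)->] := v1 i iv j; rewrite mulr0.
- move=> j jv k kv; rewrite mxE; apply: big1 => l _.
  have [lv|lv] := boolP (l \in qf_virt F').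
    by rewrite (w1 _ jv _ lv) mulr0.
  by rewrite (w2 _ lv _ kv) mul0r.
Qed.

Lemma maps_generators_comp n (H H' : 'M[int]_n) A A' A'' :
  maps_generators H A A' -> maps_generators H' A' A'' ->
  maps_generators (H' *m H) A A''.
Proof.
move=> h h' i /h[k /h'[l lA e'] e]; exists l => //.
by rewrite (colM_delta _ e).
Qed.

Lemma maps_generators_id n (A : {set 'I_n}) : maps_generators 1%:M A A.
Proof. by move=> i iA; exists i => //; rewrite colE mul1mx. Qed.

Lemma quantum_fan_iso_id d n (F : quantum_fan d n) :
  quantum_fan_iso F F 1%:M 1%:M.
Proof.
have h : quantum_fan_iso_half F F 1%:M 1%:M.
  split; first exact: quantum_fan_mor_id.
  - exact: maps_generators_id.
  - exact: maps_generators_id.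
by split; rewrite ?unitmx1 ?invmx1.
Qed.

Lemma quantum_fan_iso_comp d n (F F' F'' : quantum_fan d n) L H L' H' :
  quantum_fan_iso F F' L H -> quantum_fan_iso F' F'' L' H' ->
  quantum_fan_iso F F'' (L' *m L) (H' *m H).
Proof.
have hc (G G' G'' : quantum_fan d n) K M K' M' :
    quantum_fan_iso_half G G' K M -> quantum_fan_iso_half G' G'' K' M' ->
    quantum_fan_iso_half G G'' (K' *m K) (M' *m M).
  move=> [m1 g1 v1] [m2 g2 v2]; split; first exact: quantum_fan_mor_comp m1 m2.
  - exact: maps_generators_comp g1 g2.
  - exact: maps_generators_comp v1 v2.
move=> [uL uH h1 h2] [uL' uH' h1' h2']; split.
- by rewrite unitmx_mul uL' uL.
- by rewrite unitmx_mul uH' uH.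
- exact: hc h1 h1'.
- by rewrite !invmxM //; exact: hc h2' h2.
Qed.

End QuantumFans.

Arguments quantum_fan : clear implicits.
Arguments Omega R {d m}.

Section ModuliPrestack.
Context {R : realType}.
Implicit Types S T U : manifold R.

Definition smooth_family T p q (h : T -> 'M[R]_(p, q)) : Prop :=
  forall t i j, smooth_at t (fun s => h s i j).

Definition locally_constant T (X : Type) (g : T -> X) : Prop :=
  forall t, \forall s \near t, g s = g t.

Lemma smooth_at_germ2 T (op : R -> R -> R) (t : T) (f g : T -> R) :
  (forall k (p : 'rV[R]_k) f g, smooth_germ p f -> smooth_germ p g ->
     smooth_germ p (fun x => op (f x) (g x))) ->
  smooth_at t f -> smooth_at t g -> smooth_at t (fun s => op (f s) (g s)).
Proof.
move=> hop sf sg; have [U [phi [Ut inj _ _ chart]]] := manifold_chart t.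
have Ut' : U t by exact: nbhs_singleton (open_nbhs_nbhs Ut).
pose psi y := xget t [set s | U s /\ phi s = y].
have psiK s : U s -> psi (phi s) = s.
  move=> Us; rewrite /psi; case: xgetP => [s' _ [Us' e]|/(_ s)[]//].
  exact: inj.
have back (u : T -> R) : \forall s \near t, u s = (u \o psi \o phi) s.
  by apply: filterS (open_nbhs_nbhs Ut) => s Us; rewrite /= psiK.
have germ (u : T -> R) : smooth_at t u -> smooth_germ (phi t) (u \o psi).
  by move=> su; apply/chart => //; apply: smooth_at_local su; exact: back.
have H := hop _ _ _ _ (germ _ sf) (germ _ sg).
move/(chart _ _ Ut') : H; apply: smooth_at_local.
by apply: filterS (open_nbhs_nbhs Ut) => s Us; rewrite /= psiK.
Qed.

Lemma smooth_at_cst T (t : T) (c : R) : smooth_at t (fun=> c).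
Proof.
have [U [phi [Ut _ _ _ chart]]] := manifold_chart t.
have Ut' : U t by exact: nbhs_singleton (open_nbhs_nbhs Ut).
exact: (chart _ (fun=> c) Ut').2 (smooth_germ_cst _ _).
Qed.

Lemma smooth_family_mul T p q r (A : T -> 'M[R]_(p, q)) (B : T -> 'M[R]_(q, r)) :
  smooth_family A -> smooth_family B -> smooth_family (fun t => A t *m B t).
Proof.
move=> sA sB t i j.
have -> : (fun s => (A s *m B s) i j) =
          (fun s => \sum_(k <- enum 'I_q) A s i k * B s k j).
  by apply/funext => s; rewrite mxE big_enum.
elim: (enum 'I_q) => [|k l IH].
  have -> : (fun s => \sum_(k <- [::]) A s i k * B s k j) = (fun=> 0).
    by apply/funext => s; rewrite big_nil.
  exact: smooth_at_cst.
have -> : (fun s => \sum_(k0 <- k :: l) A s i k0 * B s k0 j) =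
   (fun s => A s i k * B s k j + \sum_(k0 <- l) A s i k0 * B s k0 j).
  by apply/funext => s; rewrite big_cons.
apply: (@smooth_at_germ2 _ +%R) => //; first by move=> *; exact: smooth_germD.
apply: (@smooth_at_germ2 _ *%R) => //; first by move=> *; exact: smooth_germM.
Qed.

Lemma smooth_family_cst T p q (A : 'M[R]_(p, q)) : smooth_family (fun _ : T => A).
Proof. by move=> t i j; exact: smooth_at_cst. Qed.

Lemma smooth_family_comp S T p q (f : smap S T) (A : T -> 'M[R]_(p, q)) :
  smooth_family A -> smooth_family (A \o f).
Proof. by move=> sA s i j; have [_ h] := smapP f; exact: (h _ _ (sA (f s) i j)). Qed.

Lemma locally_constant_comp S T (X : Type) (f : smap S T) (g : T -> X) :
  locally_constant g -> locally_constant (g \o f).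
Proof. by move=> lg s; have [cf _] := smapP f; exact: (cf s _ (lg (f s))). Qed.

Lemma locally_constant2 T (X Y Z : Type) (op : X -> Y -> Z) (f : T -> X) (g : T -> Y) :
  locally_constant f -> locally_constant g -> locally_constant (fun t => op (f t) (g t)).
Proof. by move=> lf lg t; apply: filterS2 (lf t) (lg t) => s -> ->. Qed.

Lemma locally_constant_cst T (X : Type) (x : X) : locally_constant (fun _ : T => x).
Proof. by move=> t; exact: nearW. Qed.

Variables (d n : nat) (D : {set {set 'I_n}}) (I : {set 'I_n}).

Record calibration_family T := CalibrationFamily {
  cal :> T -> 'M[R]_(d, n);
  cal_smooth : smooth_family cal;
  cal_admissible : forall t, admissible D I (cal t) }.

Record fan_arrow S T (h : calibration_family S) (h' : calibration_family T) :=
  FanArrow {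
    fan_base : smap S T;
    fan_L : S -> 'M[R]_d;
    fan_H : S -> 'M[int]_n;
    fan_L_smooth : smooth_family fan_L;
    fan_H_locally_constant : locally_constant fan_H;
    fan_iso : forall s, quantum_fan_iso
      (fan_of D I (h s)) (fan_of D I (h' (fan_base s))) (fan_L s) (fan_H s) }.

Lemma fan_arrow_eq S T (h : calibration_family S) (h' : calibration_family T)
    (a b : fan_arrow h h') :
  fan_base a = fan_base b -> fan_L a = fan_L b -> fan_H a = fan_H b -> a = b.
Proof.
case: a b => f L H p1 p2 p3 [f' L' H' q1 q2 q3] /= e1 e2 e3.
case: _ / e1 q3 => q3; case: _ / e2 q1 q3 => q1 q3; case: _ / e3 q2 q3 => q2 q3.
by congr FanArrow; exact: Prop_irrelevance.
Qed.

Definition fan_arrow_id T (h : calibration_family T) : fan_arrow h h :=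
  @FanArrow _ _ h h (sid T) (fun=> 1%:M) (fun=> 1%:M)
    (smooth_family_cst _) (@locally_constant_cst _ _ _)
    (fun t => quantum_fan_iso_id _).

Definition fan_arrow_comp S T U (h : calibration_family S)
    (h' : calibration_family T) (h'' : calibration_family U)
    (b : fan_arrow h' h'') (a : fan_arrow h h') : fan_arrow h h'' :=
  @FanArrow _ _ h h'' (scomp (fan_base b) (fan_base a))
    (fun s => fan_L b (fan_base a s) *m fan_L a s)
    (fun s => fan_H b (fan_base a s) *m fan_H a s)
    (smooth_family_mul (smooth_family_comp (fan_base a) (@fan_L_smooth _ _ _ _ b))
       (@fan_L_smooth _ _ _ _ a))
    (locally_constant2 mulmx
       (locally_constant_comp (fan_base a) (@fan_H_locally_constant _ _ _ _ b))
       (@fan_H_locally_constant _ _ _ _ a))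
    (fun s => quantum_fan_iso_comp (@fan_iso _ _ _ _ a s)
       (@fan_iso _ _ _ _ b (fan_base a s))).

(* The groupoid of D-admissible calibrations and isomorphisms of fans, over a
   manifold T: smooth maps from T to the space of matrices with values in the
   admissible ones (a possibly singular subset), with isomorphisms (L, H) for
   which L : T -> GL_d(R) is smooth and H : T -> GL_n(Z) locally constant. *)
Definition moduli_prestack : catover R.
Proof.
exists calibration_family fan_arrow fan_base fan_arrow_id fan_arrow_comp => //.
- move=> S T x y a; apply: fan_arrow_eq; first exact: smap_eq.
  + by apply/funext => s /=; rewrite mul1mx.
  + by apply/funext => s /=; rewrite mul1mx.
- move=> S T x y a; apply: fan_arrow_eq; first exact: smap_eq.
  + by apply/funext => s /=; rewrite mulmx1.
  + by apply/funext => s /=; rewrite mulmx1.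
- move=> S T U V x y z w c b a; apply: fan_arrow_eq; first exact: smap_eq.
  + by apply/funext => s /=; rewrite mulmxA.
  + by apply/funext => s /=; rewrite mulmxA.
Defined.

End ModuliPrestack.

Arguments moduli_prestack R d {n}.

Section Group.
Context {n : nat} (D : {set {set 'I_n}}) (I : {set 'I_n}).

Definition free_gens : {set 'I_n} := (~: (rays D :|: I))%SET.
Local Notation J := free_gens.
Local Notation disj A B := (fintype.disjoint (mem A) (mem B)).
Implicit Types (S : {set 'I_n}) (s t : {perm 'I_n}).

(* Aut_Poset(D), each automorphism phi being identified with the permutation t of
   the rays such that phi {i} = {t i}; permutations of a subset S of 'I_n are
   represented by the permutations of 'I_n supported in S. *)
Definition poset_aut : {set {perm 'I_n}} :=
  [set t : {perm 'I_n} | perm_on (rays D) t &&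
    [exists phi : {perm {K : {set 'I_n} | K \in D}},
      [forall x, forall y, (val (phi x) \subset val (phi y)) == (val x \subset val y)] &&
      [forall x, forall i, (val x == [set i]%SET) ==> (val (phi x) == [set t i]%SET)]]]%SET.

Lemma poset_autP (t : {perm 'I_n}) : reflect (perm_on (rays D) t /\
    exists phi : {perm {K : {set 'I_n} | K \in D}},
      (forall x y, (val (phi x) \subset val (phi y)) = (val x \subset val y)) /\
      (forall x i, val x = [set i]%SET -> val (phi x) = [set t i]%SET))
  (t \in poset_aut).
Proof.
rewrite inE; apply: (iffP andP).
  move=> [ont /existsP[phi /andP[/forallP h1 /forallP h2]]]; split=> //.
  exists phi; split=> [x y|x i e]; first by have /forallP/(_ y)/eqP := h1 x.
  by have /forallP/(_ i) := h2 x; rewrite e eqxx => /eqP.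
move=> [ont [phi [h1 h2]]]; split=> //; apply/existsP; exists phi.
apply/andP; split; apply/forallP => x; apply/forallP => y; first exact/eqP.
by apply/implyP => /eqP/h2/eqP.
Qed.

Lemma poset_aut_perm_on t : t \in poset_aut -> perm_on (rays D) t.
Proof. by case/poset_autP. Qed.

Lemma poset_aut1 : 1%g \in poset_aut.
Proof.
apply/poset_autP; split; first exact: perm_on1.
by exists 1%g; split=> [x y|x i]; rewrite !perm1.
Qed.

Lemma poset_autM s t : s \in poset_aut -> t \in poset_aut -> (s * t)%g \in poset_aut.
Proof.
move=> /poset_autP[os [phi [p1 p2]]] /poset_autP[ot [psi [q1 q2]]].
apply/poset_autP; split; first exact: perm_onM.
exists (phi * psi)%g; split=> [x y|x i e]; rewrite !permM ?q1 ?p1 //.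
by apply: q2; exact: p2.
Qed.

Lemma poset_autV t : t \in poset_aut -> t^-1%g \in poset_aut.
Proof.
move=> tD; have -> : t^-1%g = (t ^+ (#[t]%g).-1)%g by rewrite invg_expg.
by elim: (#[t]%g).-1 => [|k IH]; rewrite ?poset_aut1 // expgS poset_autM.
Qed.

(* P_t on Z^S, extended by 0, and the inclusion of Z^S in Z^n *)
Definition perm_block (S : {set 'I_n}) (t : {perm 'I_n}) : 'M[int]_n :=
  \matrix_(i, j) ((j \in S) && (i == t j))%:R.

Definition incl_mx (S : {set 'I_n}) : 'M[int]_(n, #|S|) :=
  \matrix_(i, k) (i == enum_val k)%:R.

Lemma tr_incl_mulE S p (A : 'M[int]_(n, p)) k j :
  ((incl_mx S)^T *m A) k j = A (enum_val k) j.
Proof.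
rewrite mxE (bigD1 (enum_val k)) //= !mxE eqxx mul1r big1 ?addr0 // => i ik.
by rewrite !mxE (negbTE ik) mul0r.
Qed.

Lemma incl_mxK S : (incl_mx S)^T *m incl_mx S = 1%:M.
Proof.
apply/matrixP => k l; rewrite tr_incl_mulE !mxE.
by rewrite (inj_eq enum_val_inj).
Qed.

Lemma incl_mx_disj S S' : disj S S' -> (incl_mx S)^T *m incl_mx S' = 0.
Proof.
move=> dS; apply/matrixP => k l; rewrite tr_incl_mulE !mxE.
case: eqP => // e; have := disjointFr dS (enum_valP k).
by rewrite e enum_valP.
Qed.

Lemma perm_block_mulE S t p (A : 'M[int]_(n, p)) i j :
  (perm_block S t *m A) i j = (t^-1%g i \in S)%:R * A (t^-1%g i) j.
Proof.
rewrite mxE (bigD1 (t^-1%g i)) //= !mxE permKV eqxx andbT big1 ?addr0 // => k ki.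
rewrite !mxE; case: (i =P t k) => [e|_]; last by rewrite andbF mul0r.
by rewrite e permK eqxx in ki.
Qed.

Lemma perm_on_memV S (t : {perm 'I_n}) i : perm_on S t -> (t^-1%g i \in S) = (i \in S).
Proof. by move=> ot; rewrite -(perm_closed _ ot) permKV. Qed.

Lemma perm_blockM S s t : perm_on S s -> perm_on S t ->
  perm_block S s *m perm_block S t = perm_block S (t * s)%g.
Proof.
move=> os ot; apply/matrixP => i j; rewrite perm_block_mulE !mxE permM.
rewrite (perm_on_memV i os) -(can2_eq (permKV s) (permK s)).
case: (boolP (j \in S)) => jS /=; last by rewrite mulr0.
case: eqP => [e|]; last by rewrite mulr0.
have : s^-1%g i \in S by rewrite e perm_closed.
by rewrite perm_on_memV // => ->.
Qed.

Lemma perm_block_incl S t : perm_on S t ->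
  perm_block S t *m incl_mx S =
  incl_mx S *m ((incl_mx S)^T *m perm_block S t *m incl_mx S).
Proof.
move=> ot; apply/matrixP => i k; rewrite [RHS]mxE.
have [iS|iS] := boolP (i \in S); last first.
  rewrite perm_block_mulE perm_on_memV // (negbTE iS) mul0r big1 // => l _.
  rewrite mxE; case: eqP => [e|]; last by rewrite mul0r.
  by rewrite e enum_valP in iS.
have rK : enum_val (enum_rank_in iS i) = i by exact: enum_rankK_in.
rewrite (bigD1 (enum_rank_in iS i)) //= -mulmxA tr_incl_mulE.
rewrite rK [X in _ = X * _ + _]mxE rK eqxx mul1r big1 ?addr0 // => l li.
rewrite mxE; case: eqP => [e|]; last by rewrite mul0r.
by case/eqP: li; apply: enum_val_inj; rewrite rK -e.
Qed.

Lemma perm_block_incl_disj S S' t : disj S S' -> perm_on S t ->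
  perm_block S t *m incl_mx S' = 0.
Proof.
move=> dS ot; apply/matrixP => i k; rewrite perm_block_mulE perm_on_memV // !mxE.
case: eqP => [e|]; last by rewrite mulr0.
suff : t^-1%g i \notin S by rewrite perm_on_memV // => /negbTE->; rewrite mul0r.
by rewrite e (disjointFl dS (enum_valP k)).
Qed.

Lemma tr_incl_perm_block_disj S S' t : disj S S' -> perm_on S t ->
  (incl_mx S')^T *m perm_block S t = 0.
Proof.
move=> dS ot; apply/matrixP => k j; rewrite tr_incl_mulE !mxE.
case: (boolP (j \in S)) => //= jS; case: eqP => // e.
by have := disjointFl dS (enum_valP k); rewrite e perm_closed // jS.
Qed.

Lemma perm_block_disj S S' s t : disj S S' -> perm_on S s -> perm_on S' t ->
  perm_block S s *m perm_block S' t = 0.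
Proof.
move=> dS os ot; apply/matrixP => i j.
rewrite perm_block_mulE perm_on_memV // !mxE.
case: (boolP (j \in S')) => jS' /=; last by rewrite mulr0.
case: eqP => [e|]; last by rewrite mulr0.
have sS' : s^-1%g i \in S' by rewrite e perm_closed.
by rewrite -(perm_on_memV i os) (disjointFl dS sS') mul0r.
Qed.

(* The set Aut_Poset(D) x (Z^D(1))^J x GL_J(Z) x S_I; the j-th column of the
   second component is alpha_j. *)
Definition sym_data : Type :=
  ({perm 'I_n} * 'M[int]_(#|rays D|, #|J|) * 'M[int]_#|J| * {perm 'I_n})%type.

Definition sym_pred (g : sym_data) : bool :=
  let: (t, al, A, s) := g in [&& t \in poset_aut, A \in unitmx & perm_on I s].

Definition sym_group : Type := {g : sym_data | sym_pred g}.

HB.instance Definition _ := Choice.on sym_group.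

Implicit Types g : sym_group.
Definition tau g : {perm 'I_n} := (val g).1.1.1.
Definition alpha g : 'M[int]_(#|rays D|, #|J|) := (val g).1.1.2.
Definition gl g : 'M[int]_#|J| := (val g).1.2.
Definition sigma g : {perm 'I_n} := (val g).2.

(* the matrix H, as a sum over its blocks *)
Definition Hmx g : 'M[int]_n :=
  perm_block (rays D) (tau g)
  + incl_mx (rays D) *m alpha g *m (incl_mx J)^T
  + incl_mx J *m gl g *m (incl_mx J)^T
  + perm_block I (sigma g).

(* P_t as a matrix of endomorphism of Z^D(1) *)
Definition ray_perm_mx (t : {perm 'I_n}) : 'M[int]_#|rays D| :=
  (incl_mx (rays D))^T *m perm_block (rays D) t *m incl_mx (rays D).

Lemma sym_groupP g :
  [/\ tau g \in poset_aut, gl g \in unitmx & perm_on I (sigma g)].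
Proof. by case: g => [[[[t al] A] s] p]; have /and3P := p. Qed.

Lemma sym_group_eq g g' : tau g = tau g' -> alpha g = alpha g' ->
  gl g = gl g' -> sigma g = sigma g' -> g = g'.
Proof.
rewrite /tau /alpha /gl /sigma => e1 e2 e3 e4; apply: val_inj.
by move: e1 e2 e3 e4; case: (val g) => [[[? ?] ?] ?];
  case: (val g') => [[[? ?] ?] ?] /= -> -> -> ->.
Qed.

Fact sym_one_subproof : sym_pred (1%g, 0, 1%:M, 1%g).
Proof. by rewrite /= poset_aut1 unitmx1 perm_on1. Qed.
Definition sym_one : sym_group := exist (fun x => is_true (sym_pred x)) _ sym_one_subproof.

Fact sym_mul_subproof g g' : sym_pred
  ((tau g' * tau g)%g, ray_perm_mx (tau g) *m alpha g' + alpha g *m gl g',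
   gl g *m gl g', (sigma g' * sigma g)%g).
Proof.
have [t1 A1 s1] := sym_groupP g; have [t2 A2 s2] := sym_groupP g'.
by rewrite /= poset_autM // unitmx_mul A1 A2 perm_onM.
Qed.
(* products of permutations in {perm _} compose from left to right *)
Definition sym_mul g g' : sym_group := exist (fun x => is_true (sym_pred x)) _ (sym_mul_subproof g g').

Fact sym_inv_subproof g : sym_pred
  ((tau g)^-1%g, - (ray_perm_mx (tau g)^-1%g *m alpha g *m invmx (gl g)),
   invmx (gl g), (sigma g)^-1%g).
Proof.
have [t1 A1 s1] := sym_groupP g.
by rewrite /= poset_autV // unitmx_inv A1 perm_onV.
Qed.
Definition sym_inv g : sym_group := exist (fun x => is_true (sym_pred x)) _ (sym_inv_subproof g).

Lemma ray_perm_mxM s t : perm_on (rays D) s -> perm_on (rays D) t ->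
  ray_perm_mx s *m ray_perm_mx t = ray_perm_mx (t * s)%g.
Proof.
move=> os ot; have := perm_block_incl ot.
rewrite /ray_perm_mx -perm_blockM //.
set E := incl_mx _; set A := perm_block _ s; set B := perm_block _ t => e.
by rewrite (mulmxA E^T A B) -(mulmxA (E^T *m A) B E) e !mulmxA.
Qed.

Lemma ray_perm_mx1 : ray_perm_mx 1%g = 1%:M.
Proof.
apply/matrixP => k l; rewrite /ray_perm_mx -mulmxA tr_incl_mulE perm_block_mulE.
by rewrite invg1 perm1 enum_valP mul1r !mxE (inj_eq enum_val_inj).
Qed.

Fact sym_mulA : associative sym_mul.
Proof.
move=> a b c; have [/poset_aut_perm_on ta _ _] := sym_groupP a.
have [/poset_aut_perm_on tb _ _] := sym_groupP b.
apply: sym_group_eq; rewrite /tau /alpha /gl /sigma /=.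
- by rewrite mulgA.
- by rewrite -ray_perm_mxM // !mulmxDr !mulmxDl !mulmxA addrA.
- by rewrite mulmxA.
- by rewrite mulgA.
Qed.

Fact sym_mul1g : left_id sym_one sym_mul.
Proof.
move=> a; apply: sym_group_eq; rewrite /tau /alpha /gl /sigma /=.
- by rewrite mulg1.
- by rewrite /tau /gl /= ray_perm_mx1 !mul1mx mul0mx addr0.
- by rewrite mul1mx.
- by rewrite mulg1.
Qed.

Fact sym_mulg1 : right_id sym_one sym_mul.
Proof.
move=> a; apply: sym_group_eq; rewrite /tau /alpha /gl /sigma /=.
- by rewrite mul1g.
- by rewrite mulmx0 mulmx1 add0r.
- by rewrite mulmx1.
- by rewrite mul1g.
Qed.

Fact sym_mulVg : left_inverse sym_one sym_inv sym_mul.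
Proof.
move=> a; have [ta Aa sa] := sym_groupP a.
apply: sym_group_eq; rewrite /tau /alpha /gl /sigma /=.
- by rewrite mulgV.
- by rewrite mulNmx mulmxKV // subrr.
- by rewrite mulVmx.
- by rewrite mulgV.
Qed.

Fact sym_mulgV : right_inverse sym_one sym_inv sym_mul.
Proof.
move=> a; have [/poset_aut_perm_on ta Aa sa] := sym_groupP a.
apply: sym_group_eq; rewrite /tau /alpha /gl /sigma /=.
- by rewrite mulVg.
- have -> : alpha (sym_inv a) =
      - (ray_perm_mx (tau a)^-1%g *m (alpha a *m invmx (gl a))) by rewrite mulmxA.
  rewrite mulmxN (mulmxA (ray_perm_mx _) (ray_perm_mx _)) ray_perm_mxM ?perm_onV // mulVg.
  rewrite ray_perm_mx1 mul1mx.
  by rewrite addNr.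
- by rewrite mulmxV.
- by rewrite mulVg.
Qed.

HB.instance Definition _ := isGroup.Build sym_group
  sym_mulA sym_mul1g sym_mulg1 sym_mulVg sym_mulgV.

Lemma HmxM g g' : I \subset (~: rays D)%SET -> Hmx (g * g')%g = Hmx g *m Hmx g'.
Proof.
rewrite -finset.disjoints_subset => dI; have [/poset_aut_perm_on t1 A1 s1] := sym_groupP g.
have [/poset_aut_perm_on t2 A2 s2] := sym_groupP g'.
have dRI : disj (rays D) I by rewrite disjoint_sym.
have dRJ : disj (rays D) J.
  by rewrite -finset.setI_eq0 /J finset.setCU finset.setIA finset.setICr finset.set0I.
have dJR : disj J (rays D) by rewrite disjoint_sym.
have dIJ : disj I J.
  by rewrite -finset.setI_eq0 /J finset.setCU finset.setICA finset.setICr finset.setI0.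
have dJI : disj J I by rewrite disjoint_sym.
have HE k : Hmx k = perm_block (rays D) (tau k)
  + (incl_mx (rays D) *m alpha k + incl_mx J *m gl k) *m (incl_mx J)^T
  + perm_block I (sigma k).
  by rewrite /Hmx mulmxDl !addrA.
rewrite !HE /=.
have -> : tau (g * g')%g = (tau g' * tau g)%g by [].
have -> : sigma (g * g')%g = (sigma g' * sigma g)%g by [].
have -> : gl (g * g')%g = gl g *m gl g' by [].
have -> : alpha (g * g')%g =
  ray_perm_mx (tau g) *m alpha g' + alpha g *m gl g' by [].
rewrite -!perm_blockM //.
set A := perm_block _ (tau g); set A' := perm_block _ (tau g').
set B := perm_block _ (sigma g); set B' := perm_block _ (sigma g').
set E := incl_mx (rays D); set F := incl_mx J.
have [Z ZE] : exists Z, Z = E *m alpha g + F *m gl g by eexists.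
have [Z' ZE'] : exists Z, Z = E *m alpha g' + F *m gl g' by eexists.
have AB' : A *m B' = 0 by exact: perm_block_disj.
have BA' : B *m A' = 0 by exact: perm_block_disj.
have FA' : F^T *m A' = 0 by exact: tr_incl_perm_block_disj.
have FB' : F^T *m B' = 0 by exact: tr_incl_perm_block_disj.
have BZ' : B *m Z' = 0.
  by rewrite ZE' mulmxDr !mulmxA /B /E /F !perm_block_incl_disj // !mul0mx addr0.
have FZ' : F^T *m Z' = gl g'.
  by rewrite ZE' mulmxDr !mulmxA incl_mx_disj // incl_mxK mul0mx mul1mx add0r.
have AZ' : A *m Z' = E *m ray_perm_mx (tau g) *m alpha g'.
  rewrite ZE' mulmxDr !mulmxA [A *m F]perm_block_incl_disj // mul0mx addr0.
  by rewrite (perm_block_incl t1) !mulmxA.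
rewrite -ZE -ZE' !mulmxDl !mulmxDr.
rewrite -!(mulmxA Z) FA' FB' !mulmx0 (mulmxA F^T) FZ' AB' BA' (mulmxA B) BZ'.
by rewrite mul0mx (mulmxA A) AZ' !addr0 ZE !mulmxDl !add0r !mulmxA !addrA.
Qed.

End Group.


Section QuotientStacks.
Context {R : realType}.
Implicit Types S T U V : manifold R.

Definition group_action_on (G : groupType) (V : Type) (X : set V) (act : G -> V -> V) :
    Prop :=
  [/\ forall g x, X x -> X (act g x),
      forall x, X x -> act 1%g x = x &
      forall g g' x, X x -> act (g * g')%g x = act g (act g' x)].

Section ActionPrestack.
Variables (G : groupType) (p q : nat) (X : set 'M[R]_(p, q)).
Variable act : G -> 'M[R]_(p, q) -> 'M[R]_(p, q).
Hypothesis Xact : group_action_on X act.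

Record point_family T := PointFamily {
  pt :> T -> 'M[R]_(p, q);
  pt_smooth : smooth_family pt;
  pt_in : forall t, X (pt t) }.

Record action_arrow S T (x : point_family S) (y : point_family T) := ActionArrow {
  action_base : smap S T;
  action_elt : S -> G;
  action_elt_locally_constant : locally_constant action_elt;
  action_eltP : forall s, act (action_elt s) (x s) = y (action_base s) }.

Lemma action_arrow_eq S T (x : point_family S) (y : point_family T)
    (a b : action_arrow x y) :
  action_base a = action_base b -> action_elt a = action_elt b -> a = b.
Proof.
case: a b => f g p1 p2 [f' g' q1 q2] /= e1 e2.
case: _ / e1 q2 => q2; case: _ / e2 q1 q2 => q1 q2.
by congr ActionArrow; exact: Prop_irrelevance.
Qed.

Fact action_id_subproof T (x : point_family T) t : act 1%g (x t) = x (sid T t).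
Proof. by case: Xact => _ -> //; exact: pt_in. Qed.

Definition action_id T (x : point_family T) : action_arrow x x :=
  ActionArrow (@locally_constant_cst _ T _ 1%g) (@action_id_subproof T x).

Fact action_comp_subproof S T U (x : point_family S) (y : point_family T)
    (z : point_family U) (b : action_arrow y z) (a : action_arrow x y) s :
  act (action_elt b (action_base a s) * action_elt a s)%g (x s) =
  z (scomp (action_base b) (action_base a) s).
Proof.
by case: Xact => _ _ ->; [rewrite !action_eltP|exact: pt_in].
Qed.

Definition action_comp S T U (x : point_family S) (y : point_family T)
    (z : point_family U) (b : action_arrow y z) (a : action_arrow x y) :
    action_arrow x z :=
  ActionArrow
    (locally_constant2 (fun g g' : G => (g * g')%g)
       (locally_constant_comp (action_base a) (@action_elt_locally_constant _ _ _ _ b))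
       (@action_elt_locally_constant _ _ _ _ a))
    (action_comp_subproof b a).

(* The translation groupoid of the action of the discrete group G on X, over a
   manifold T: smooth families of points of X, with locally constant maps to G.
   The quotient stack [X/G] is the associated stack. *)
Definition action_prestack : catover R.
Proof.
exists point_family action_arrow action_base action_id action_comp => //.
- move=> S T x y a; apply: action_arrow_eq; first exact: smap_eq.
  by apply/funext => s /=; rewrite mul1g.
- move=> S T x y a; apply: action_arrow_eq; first exact: smap_eq.
  by apply/funext => s /=; rewrite mulg1.
- move=> S T U V x y z w c b a; apply: action_arrow_eq; first exact: smap_eq.
  by apply/funext => s /=; rewrite mulgA.
Defined.

End ActionPrestack.

(* (t, alpha, A, s) . h = L h H^-1, where L is the inverse of the matrix with
   columns h(e_{t^-1(1)}), ..., h(e_{t^-1(d)}) *)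
Definition Omega_act d m (D : {set {set 'I_(d + m)}}) (I : {set 'I_(d + m)})
    (g : sym_group D I) (w : 'M[R]_(d, m)) : 'M[R]_(d, m) :=
  let h := row_mx 1%:M w in
  let L := invmx (\matrix_(i < d, j < d) h i ((tau g)^-1%g (lshift m j))) in
  rsubmx (L *m h *m invmx (intmx (Hmx g))).

End QuotientStacks.

Arguments Omega_act R {d m}.

(* Main.v *)
Require Import Defs.
From mathcomp Require Import all_boot all_order all_algebra all_fingroup.
From mathcomp Require Import all_classical all_reals all_analysis.

Set Implicit Arguments.
Unset Strict Implicit.
Unset Printing Implicit Defensive.

Import Order.TTheory GRing.Theory Num.Theory.
Import numFieldNormedType.Exports.

Local Open Scope classical_set_scope.
Local Open Scope ring_scope.

(** The two stacks are the stackifications of two groupoids over manifolds: that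
    of D-admissible calibrations with isomorphisms of fans, and the translation
    groupoid of the action on Omega(D).  These groupoids are already equivalent
    before stackification, and the universal property carries the equivalence
    over to the stacks ([stackification_equiv]).

    One functor sends a point w of Omega(D) to the calibration (1 | w) and a group
    element g to the pair (L, H) of the statement.  Its quasi-inverse normalizes a
    calibration h to h_0^-1 h, where h_0 is the block of the first d columns.

    The normalization exists globally because h_0 is invertible for every
    admissible h ([admissible_lsubmx]).  In one fan of type D the cone on 1, ..., d
    is simplicial, so all subsets of {1, ..., d} are in D.  In any other fan of
    type D a linear relation between the first d generators would, by separating
    its positive and negative coefficients, contradict the fact that the positive
    part spans a face ([comb_free]).

    The functors are inverse on arrows because the integral part H of an
    isomorphism of fans of type D with virtual generators I is exactly one of the
    block matrices: H permutes the ray generators and the virtual generators, the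
    permutation of the rays preserves D because L sends cones onto cones, and the
    compatibility with virtual generators forces the remaining zero blocks
    ([Hmx_surj], [iso_HmxP]).  Conversely every block matrix preserves
    admissibility ([admissible_Hmx]) and gives isomorphisms ([iso_Hmx]).  Once H is
    fixed, L is determined between normalized calibrations, since L must send the
    first d columns of h H^-1 to the identity matrix ([Omega_act_unique]); this
    single uniqueness statement gives the axioms of the action, the functoriality
    and the naturality.  Finally L depends smoothly on the calibration, as the
    inverse of a smooth family of invertible matrices ([smooth_family_invmx]). *)

(** * Equivalent prestacks have equivalent stackifications *)

Section FormalStacks.
Context {R : realType}.
Implicit Types X Y Z M : catover R.

Lemma smap_comp1 (S T : manifold R) (f : smap S T) : scomp (sid T) f = f.
Proof. exact: smap_eq. Qed.

Lemma smap_comps1 (S T : manifold R) (f : smap S T) : scomp f (sid S) = f.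
Proof. exact: smap_eq. Qed.

Definition nat_id X Y (F : funover X Y) : nat_over F F.
Proof.
exists (fun T x => fid Y (F T x)) => [T x|S T x y a].
  exact: fover_id.
by rewrite fcomp_idl fcomp_idr.
Defined.

Definition nat_comp X Y (F G K : funover X Y) (b : nat_over G K)
  (a : nat_over F G) : nat_over F K.
Proof.
exists (fun T x => fcomp (b T x) (a T x)) => [T x|S T x y f].
  by rewrite fover_comp !nat_over_id smap_comp1.
by rewrite -fcompA nat_natural fcompA nat_natural -fcompA.
Defined.

Lemma iso_over_sym X Y (F G : funover X Y) : iso_over F G -> iso_over G F.
Proof. by move=> [a [b ab]]; exists b, a => T x; case: (ab T x). Qed.

Lemma iso_over_trans X Y (F G K : funover X Y) :
  iso_over F G -> iso_over G K -> iso_over F K.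
Proof.
move=> [a [b ab]] [a' [b' ab']].
exists (nat_comp a' a), (nat_comp b b') => T x /=.
have [e1 e2] := ab T x; have [e1' e2'] := ab' T x; split.
  by rewrite -fcompA (fcompA (b' T x)) e1' fcomp_idl.
by rewrite -fcompA (fcompA (a T x)) e2 fcomp_idl.
Qed.

(** The inverse family need only be given objectwise: that it lies over the
    identity and is natural follows from the same properties of [a]. *)
Lemma iso_over_components X Y (F G : funover X Y)
    (a : forall T (x : fob X T), fhom Y (F T x) (G T x))
    (b : forall T (x : fob X T), fhom Y (G T x) (F T x)) :
  (forall T (x : fob X T), fover (a T x) = sid T) ->
  (forall S T (x : fob X S) (y : fob X T) (f : fhom X x y),
    fcomp (a T y) (fun_hom F f) = fcomp (fun_hom G f) (a S x)) ->
  (forall T (x : fob X T), fcomp (b T x) (a T x) = fid Y (F T x) /\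
     fcomp (a T x) (b T x) = fid Y (G T x)) ->
  iso_over F G.
Proof.
move=> a1 aN ab; have b1 T (x : fob X T) : fover (b T x) = sid T.
  have [e _] := ab T x; rewrite -[LHS]smap_comps1 -(a1 T x) -fover_comp e.
  by rewrite fover_id.
unshelve eexists (NatOver a1 aN), (@NatOver _ _ _ _ _ b b1 _) => //.
move=> S T x y f; have [_ e] := ab S x; have [e' _] := ab T y.
rewrite -[LHS]fcomp_idr -e fcompA -(fcompA (b T y)) -aN.
by rewrite fcompA e' fcomp_idl.
Qed.

Lemma iso_over_whiskerl X Y Z (K : funover Y Z) (F G : funover X Y) :
  iso_over F G -> iso_over (compfun_over K F) (compfun_over K G).
Proof.
move=> [a [b ab]]; apply: (@iso_over_components _ _ (compfun_over K F)
  (compfun_over K G) (fun T x => fun_hom K (a T x))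
  (fun T x => fun_hom K (b T x))) => [T x|S T x y f|T x] /=.
- by rewrite fun_over nat_over_id.
- by rewrite -(fun_comp K (a T y)) nat_natural fun_comp.
- have [e1 e2] := ab T x.
  by rewrite -(fun_comp K (b T x)) -(fun_comp K (a T x)) e1 e2 !fun_id.
Qed.

Lemma iso_over_whiskerr X Y Z (F G : funover Y Z) (K : funover X Y) :
  iso_over F G -> iso_over (compfun_over F K) (compfun_over G K).
Proof.
move=> [a [b ab]]; apply: (@iso_over_components _ _ (compfun_over F K)
  (compfun_over G K) (fun T x => a T (K T x))
  (fun T x => b T (K T x))) => [T x|S T x y f|T x] /=.
- by rewrite nat_over_id.
- by rewrite nat_natural.
- exact: ab.
Qed.

Lemma compfun_overA X Y Z W (K : funover Z W) (G : funover Y Z) (F : funover X Y) :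
  iso_over (compfun_over K (compfun_over G F)) (compfun_over (compfun_over K G) F).
Proof.
apply: (@iso_over_components _ _ (compfun_over K (compfun_over G F))
  (compfun_over (compfun_over K G) F) (fun T x => fid W (K T (G T (F T x))))
  (fun T x => fid W (K T (G T (F T x))))) => *; rewrite /= ?fover_id //.
  by rewrite fcomp_idl fcomp_idr.
by rewrite fcomp_idl.
Qed.

Lemma compfun_over1 X Y (F : funover X Y) : iso_over (compfun_over F (idfun_over X)) F.
Proof.
apply: (@iso_over_components _ _ (compfun_over F (idfun_over X)) F
  (fun T x => fid Y (F T x)) (fun T x => fid Y (F T x))) => *; rewrite /= ?fover_id //.
  by rewrite fcomp_idl fcomp_idr.
by rewrite fcomp_idl.
Qed.

Lemma compfun_1over X Y (F : funover X Y) : iso_over (compfun_over (idfun_over Y) F) F.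
Proof.
apply: (@iso_over_components _ _ (compfun_over (idfun_over Y) F) F
  (fun T x => fid Y (F T x)) (fun T x => fid Y (F T x))) => *; rewrite /= ?fover_id //.
  by rewrite fcomp_idl fcomp_idr.
by rewrite fcomp_idl.
Qed.

(** Restriction along [X -> M] is fully faithful, so an isomorphism between the
    restrictions lifts together with its inverse; the two composites are
    identities because the lift of an identity is unique. *)
Lemma stackification_iso_reflect X M Y (i : funover X M) (F G : funover M Y) :
  (forall (F G : funover M Y)
       (b : nat_over (compfun_over F i) (compfun_over G i)),
       exists a : nat_over F G, (forall T (x : fob X T), a T (i T x) = b T x) /\
         forall a' : nat_over F G, (forall T (x : fob X T), a' T (i T x) = b T x) ->
           forall T (y : fob M T), a' T y = a T y) ->
  iso_over (compfun_over F i) (compfun_over G i) -> iso_over F G.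
Proof.
move=> ff [b [c bc]].
have [a [aE _]] := ff F G b; have [a' [aE' _]] := ff G F c.
have idP (K : funover M Y) (e : nat_over K K) :
    (forall T x, e T (i T x) = fid Y (K T (i T x))) ->
    forall T y, e T y = fid Y (K T y).
  move=> eE; have [e0 [_ u]] := ff K K (nat_id (compfun_over K i)).
  by move=> T y; rewrite (u e eE) -(u (nat_id K)).
exists a, a' => T y; split.
  apply: (idP F (nat_comp a' a)) => T0 x /=.
  by rewrite aE aE'; case: (bc T0 x).
apply: (idP G (nat_comp a a')) => T0 x /=.
by rewrite aE aE'; case: (bc T0 x).
Qed.

(** The equivalence [E] and its quasi-inverse extend to functors between the
    stacks; their composites restrict to the identity on the prestacks, hence are
    isomorphic to the identity. *)
Lemma stackification_equiv X X' M M' (E : funover X X') (E' : funover X' X) :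
  iso_over (compfun_over E' E) (idfun_over X) ->
  iso_over (compfun_over E E') (idfun_over X') ->
  is_stackification X M -> is_stackification X' M' -> stack_iso M M'.
Proof.
move=> hX hX' [sM [i Mi]] [sM' [j Mj]].
have [Phi PhiE] := (Mi M' sM').1 (compfun_over j E).
have [Psi PsiE] := (Mj M sM).1 (compfun_over i E').
have key (Y Y' N N' : catover R) (u : funover Y N) (v : funover Y' N')
    (G : funover Y Y') (G' : funover Y' Y) (P : funover N N') (P' : funover N' N) :
    iso_over (compfun_over G' G) (idfun_over Y) ->
    iso_over (compfun_over P u) (compfun_over v G) ->
    iso_over (compfun_over P' v) (compfun_over u G') ->
    iso_over (compfun_over (compfun_over P' P) u) (compfun_over (idfun_over N) u).
  move=> hG hP hP'.
  apply: iso_over_trans (iso_over_sym (compfun_overA _ _ _)) _.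
  apply: iso_over_trans (iso_over_whiskerl P' hP) _.
  apply: iso_over_trans (compfun_overA _ _ _) _.
  apply: iso_over_trans (iso_over_whiskerr G hP') _.
  apply: iso_over_trans (iso_over_sym (compfun_overA _ _ _)) _.
  apply: iso_over_trans (iso_over_whiskerl u hG) _.
  apply: iso_over_trans (compfun_over1 u) (iso_over_sym (compfun_1over u)).
exists Phi, Psi; split.
  exact: stackification_iso_reflect (Mi M sM).2 (key _ _ _ _ _ _ _ _ _ _ hX PhiE PsiE).
exact: stackification_iso_reflect (Mj M' sM').2 (key _ _ _ _ _ _ _ _ _ _ hX' PsiE PhiE).
Qed.

End FormalStacks.

(** * Smooth families of invertible matrices *)

Section SmoothInverse.

(** Induction on the order of differentiability: the derivative of 1/g is
    - g' / g^2, a polynomial in 1/g and g'. *)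
Lemma Cr_onV (K : realType) (E : normedModType K) r (U : set E) (g : E -> K) :
  open U -> (forall x, U x -> g x != 0) -> Cr_on r U g ->
  Cr_on r U (fun x => (g x)^-1).
Proof.
move=> oU g0; elim: r => [|r IH] hg.
  by move=> x Ux; apply: continuousV; [exact: g0|exact: hg].
have [g1 g2] := hg; split=> [x Ux|v].
  by apply: differentiableV; [exact: g1|exact: g0].
have hV := IH (Cr_onS hg).
have hN := Cr_onM oU (@Cr_on_cst _ _ r U (-1)) (Cr_onM oU hV hV).
apply: Cr_on_ext (Cr_onM oU hN (g2 v)) => // x Ux.
by rewrite (diffV (g1 _ Ux) (g0 _ Ux)) /= -expr2 exprVn mulN1r.
Qed.

Lemma smooth_germV (K : realType) (E : normedModType K) (p : E) (g : E -> K) :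
  g p != 0 -> smooth_germ p g -> smooth_germ p (fun x => (g x)^-1).
Proof.
move=> g0 [U [oU Up] hg].
have oV : open (U `&` [set x | g x != 0]).
  rewrite openE => x [Ux gx].
  have nU : nbhs x U by exact: open_nbhs_nbhs.
  have nx : \forall y \near x, g y != 0.
    exact: cvgr_neq0 (hg 0%N x Ux) gx.
  by apply: filterS2 nU nx.
exists (U `&` [set x | g x != 0]); first by [].
move=> r; apply: Cr_onV => //; first by move=> x [].
by apply: Cr_on_sub (hg r) => x [].
Qed.

Variable R : realType.
Implicit Types T : manifold R.

(** The hypothesis on [op] only concerns germs taking the value [f t]: this is
    what allows operations, such as the inverse, that are smooth only away from
    some values. *)
Lemma smooth_at_germ1 T (op : R -> R) (t : T) (f : T -> R) :
  (forall k (p : 'rV[R]_k) g, g p = f t -> smooth_germ p g ->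
     smooth_germ p (op \o g)) ->
  smooth_at t f -> smooth_at t (op \o f).
Proof.
move=> hop sf; have [U [phi [Ut inj _ _ chart]]] := manifold_chart t.
have Ut' : U t by exact: nbhs_singleton (open_nbhs_nbhs Ut).
(* a local inverse of the chart *)
pose psi y := xget t [set s | U s /\ phi s = y].
have psiK s : U s -> psi (phi s) = s.
  move=> Us; rewrite /psi; case: xgetP => [s' _ [Us' e]|/(_ s)[]//].
  exact: inj.
have near_psi (u : T -> R) : \forall s \near t, u s = u (psi (phi s)).
  by apply: filterS (open_nbhs_nbhs Ut) => s Us; rewrite psiK.
have germ : smooth_germ (phi t) (f \o psi).
  by apply/chart => //; apply: smooth_at_local sf; exact: near_psi.
have /(chart _ _ Ut') : smooth_germ (phi t) (op \o (f \o psi)).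
  by apply: hop => //=; rewrite psiK.
apply: smooth_at_local; apply: filterS (near_psi f) => s /= <- //.
Qed.

Lemma smooth_atV T (t : T) (f : T -> R) :
  f t != 0 -> smooth_at t f -> smooth_at t (fun s => (f s)^-1).
Proof.
move=> f0; apply: (@smooth_at_germ1 _ GRing.inv) => k p g e.
by apply: smooth_germV; rewrite e.
Qed.

Lemma smooth_atD T (t : T) (f g : T -> R) :
  smooth_at t f -> smooth_at t g -> smooth_at t (fun s => f s + g s).
Proof. by apply: (@smooth_at_germ2 _ _ +%R) => *; exact: smooth_germD. Qed.

Lemma smooth_atM T (t : T) (f g : T -> R) :
  smooth_at t f -> smooth_at t g -> smooth_at t (fun s => f s * g s).
Proof. by apply: (@smooth_at_germ2 _ _ *%R) => *; exact: smooth_germM. Qed.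

Lemma smooth_at_sum T (t : T) (J : Type) (r : seq J) (f : J -> T -> R) :
  (forall j, smooth_at t (f j)) -> smooth_at t (fun s => \sum_(j <- r) f j s).
Proof.
move=> hf; rewrite (_ : (fun s => _) = \sum_(j <- r) f j); last first.
  by apply/funext => s; rewrite fct_sumE.
by elim/big_ind: _ => // [|u v]; [exact: smooth_at_cst|exact: smooth_atD].
Qed.

Lemma smooth_at_prod T (t : T) (J : Type) (r : seq J) (f : J -> T -> R) :
  (forall j, smooth_at t (f j)) -> smooth_at t (fun s => \prod_(j <- r) f j s).
Proof.
move=> hf; elim: r => [|j r IH].
  rewrite (_ : (fun s => _) = fun=> 1); first exact: smooth_at_cst.
  by apply/funext => s; rewrite big_nil.
rewrite (_ : (fun s => _) = fun s => f j s * \prod_(j <- r) f j s).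
  exact: smooth_atM.
by apply/funext => s; rewrite big_cons.
Qed.

Lemma smooth_at_det T p (A : T -> 'M[R]_p) t : smooth_family A ->
  smooth_at t (fun s => \det (A s)).
Proof.
move=> sA; apply: smooth_at_sum => s; apply: smooth_atM; first exact: smooth_at_cst.
by apply: smooth_at_prod => i; exact: sA.
Qed.

(** Cramer's rule expresses the inverse through determinants. *)
Lemma smooth_family_invmx T p (A : T -> 'M[R]_p) : (forall t, A t \in unitmx) ->
  smooth_family A -> smooth_family (fun t => invmx (A t)).
Proof.
move=> uA sA t i j.
rewrite (_ : (fun s => _) = fun s => (\det (A s))^-1 *
    ((-1) ^+ (j + i) * \det (row' j (col' i (A s))))); last first.
  by apply/funext => s; rewrite /invmx uA !mxE.
apply: smooth_atM.
  apply: smooth_atV; last exact: smooth_at_det.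
  by have := uA t; rewrite unitmxE unitfE.
apply: smooth_atM; first exact: smooth_at_cst.
apply: smooth_at_det => s k l.
by rewrite (_ : (fun s => _) = fun s => A s (lift j k) (lift i l)) ?sA //;
  apply/funext => u; rewrite !mxE.
Qed.

End SmoothInverse.

(** * Cones of a fan and linear independence *)

Section Cones.
Context {R : realType}.
Implicit Types (d n : nat).

Lemma col_cone d n (h : 'M[R]_(d, n)) (K : {set 'I_n}) i : i \in K -> cone h K (col i h).
Proof.
move=> iK; exists (fun k => (k == i)%:R); split; first by move=> k; exact: ler0n.
rewrite (bigD1 i) //= eqxx scale1r big1 ?addr0 // => k /andP[_ /negbTE->].
by rewrite scale0r.
Qed.

Lemma cone_sub d n (h : 'M[R]_(d, n)) (K K' : {set 'I_n}) :
  K \subset K' -> cone h K `<=` cone h K'.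
Proof.
move=> KK' x [a [a0 ->]].
exists (fun i => if i \in K then a i else 0); split.
  by move=> i; case: ifP.
rewrite [RHS](finset.big_setID K) /= (finset.setIidPr KK') [X in _ + X]big1 ?addr0.
  by apply: eq_bigr => i ->.
by move=> i /finset.setDP[_ /negbTE->]; rewrite scale0r.
Qed.

Lemma cone1P d n (h : 'M[R]_(d, n)) i x :
  cone h [set i]%SET x <-> exists2 t : R, 0 <= t & x = t *: col i h.
Proof.
split=> [[a [a0 ->]]|[t t0 ->]]; first by exists (a i) => //; rewrite big_set1.
by exists (fun=> t); split=> //; rewrite big_set1.
Qed.

Lemma cone_mulmx d n (L : 'M[R]_d) (h : 'M[R]_(d, n)) (K : {set 'I_n}) x :
  cone h K x -> cone (L *m h) K (L *m x).
Proof.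
move=> [a [a0 ->]]; exists a; split=> //; rewrite mulmx_sumr.
by apply: eq_bigr => i _; rewrite -scalemxAr !colE mulmxA.
Qed.

Lemma cone_unitmx d n (L : 'M[R]_d) (h : 'M[R]_(d, n)) (K : {set 'I_n}) : L \in unitmx ->
  cone (L *m h) K = [set x | cone h K (invmx L *m x)].
Proof.
move=> uL; apply/seteqP; split=> x /=.
  by move=> /(cone_mulmx (invmx L)); rewrite mulKmx.
by move=> /(cone_mulmx L); rewrite mulKVmx.
Qed.

Lemma cone_perm d n (h h' : 'M[R]_(d, n)) (t : {perm 'I_n}) (K : {set 'I_n}) :
  (forall i, i \in K -> col (t i) h' = col i h) ->
  cone h' (t @: K)%SET = cone h K.
Proof.
move=> e; have sE (a : 'I_n -> R) : \sum_(i in (t @: K)%SET) a i *: col i h' =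
    \sum_(i in K) a (t i) *: col i h.
  rewrite big_imset /=; last by move=> i j _ _; exact: perm_inj.
  by apply: eq_bigr => i /e->.
apply/seteqP; split=> x [a [a0 ->]].
  by exists (a \o t); split=> [i|]; [exact: a0|rewrite sE].
exists (a \o (t^-1)%g); split=> [i|]; first exact: a0.
by rewrite sE; apply: eq_bigr => i _ /=; rewrite permK.
Qed.

Lemma linform_col d n (u : 'rV[R]_d) (h : 'M[R]_(d, n)) (a : 'I_n -> R) (P : pred 'I_n) :
  (u *m \sum_(i | P i) a i *: col i h) 0 0 = \sum_(i | P i) a i * (u *m col i h) 0 0.
Proof.
by rewrite mulmx_sumr summxE; apply: eq_bigr => i _; rewrite -scalemxAr mxE.
Qed.

Lemma spanningP d n (h : 'M[R]_(d, n)) (S : {set 'I_n}) :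
  spanning h S <-> forall x, exists v : 'cV[R]_n,
    (forall i, i \notin S -> v i 0 = 0) /\ x = h *m v.
Proof.
have colE' (v : 'cV[R]_n) : h *m v = \sum_i v i 0 *: col i h.
  apply/matrixP => k j; rewrite !mxE summxE; apply: eq_bigr => i _.
  by rewrite !mxE ord1 mulrC.
split=> hs x; have := hs x.
  move=> [a ->]; exists (\col_i if i \in S then a i else 0); split=> [i /negbTE iS|].
    by rewrite mxE iS.
  rewrite colE' big_mkcond /=; apply: eq_bigr => i _.
  by rewrite mxE; case: ifP => //; rewrite scale0r.
move=> [v [v0 ->]]; exists (fun i => v i 0); rewrite colE' [RHS]big_mkcond /=.
by apply: eq_bigr => i _; case: ifPn => // /v0->; rewrite scale0r.
Qed.

Lemma qf_gens_neq0 d n (F : quantum_fan R d n) i : is_quantum_fan F ->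
  i \in qf_gens F -> col i (qf_calib F) != 0.
Proof.
move=> qF /(qf_gens_ray qF)[_ [v v0 e]].
have : cone (qf_calib F) [set i]%SET v by rewrite e; exists 1; rewrite ?scale1r.
move=> /cone1P[t _ vE]; apply: contra_neq v0 => c0.
by rewrite vE c0 scaler0.
Qed.

(** The ray through generator [i] is a face of the fan meeting the cone on [K] in
    a face.  A linear form cutting out this face vanishes on some generator of
    [K] occurring in a positive combination equal to generator [i]; that generator
    then lies on the ray, and distinct generators span distinct rays. *)
Lemma qf_gens_mem d n (F : quantum_fan R d n) (K : {set 'I_n}) i : is_quantum_fan F ->
  K \in comb F -> i \in qf_gens F ->
  cone (qf_calib F) K (col i (qf_calib F)) -> i \in K.
Proof.
move=> qF; rewrite inE => /andP[/fintype.subsetP Kg /asboolP FK] ig iK.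
have [Fi _] := qf_gens_ray qF ig; have [[u [u0 e]] _] := qf_inter qF FK Fi.
have ui : (u *m col i (qf_calib F)) 0 0 = 0.
  suff: (cone (qf_calib F) K `&` cone (qf_calib F) [set i]%SET)
    (col i (qf_calib F)) by rewrite e => -[].
  by split=> //; apply: col_cone; rewrite finset.in_set1.
have [a [a0 iE]] := iK.
have z : forall k, k \in K -> a k * (u *m col k (qf_calib F)) 0 0 = 0.
  move: ui; rewrite iE linform_col; apply: psumr_eq0P => k kK.
  by apply: mulr_ge0; [exact: a0|apply/u0/col_cone].
have [k /andP[kK ak]] : exists k, (k \in K) && (a k != 0).
  apply/existsP; apply: contraNT (qf_gens_neq0 qF ig) => /existsPn n0.
  rewrite iE big1 ?eqxx // => k kK; have := n0 k.
  by rewrite kK negbK => /eqP->; rewrite scale0r.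
have uk : (u *m col k (qf_calib F)) 0 0 = 0.
  by have /eqP := z _ kK; rewrite mulf_eq0 (negbTE ak) => /eqP.
have : (cone (qf_calib F) K `&` cone (qf_calib F) [set i]%SET)
    (col k (qf_calib F)) by rewrite e; split=> //; exact: col_cone.
move=> [_ /cone1P[t t0 kE]].
have tn0 : t != 0.
  by apply: contra_neq (qf_gens_neq0 qF (Kg _ kK)) => t00; rewrite kE t00 scale0r.
suff -> : i = k by [].
apply: (qf_gens_inj qF) => //; first exact: Kg.
apply/seteqP; split=> x /cone1P[s s0 ->]; apply/cone1P.
  exists (s / t); first by rewrite divr_ge0.
  by rewrite kE scalerA divfK.
by exists (s * t); [rewrite mulr_ge0|rewrite kE scalerA].
Qed.

(** If all subsets of the support of a linear relation are cones of the fan, the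
    relation is trivial.  Let P be the set of positive coefficients: the cone on P
    is a face of the cone on the whole support, cut out by a linear form u.
    Applying u to the relation leaves only terms of one sign, so u vanishes on each
    generator with negative coefficient, which must then lie in P. *)
Lemma comb_free d n (F : quantum_fan R d n) (a : 'I_n -> R) : is_quantum_fan F ->
  (forall K : {set 'I_n}, (forall i, i \in K -> a i != 0) -> K \in comb F) ->
  \sum_i a i *: col i (qf_calib F) = 0 -> forall i, a i = 0.
Proof.
(* It suffices to exclude negative coefficients: apply this to a and to - a. *)
move=> qF; wlog suff H : a /
  (forall K : {set 'I_n}, (forall i, i \in K -> a i != 0) -> K \in comb F) ->
  \sum_i a i *: col i (qf_calib F) = 0 -> forall i, 0 <= a i.
  move=> aK a0 i; apply/eqP; rewrite eq_le (H a) // andbT -oppr_ge0.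
  apply: (H (fun i => - a i)) => [K Ka|].
    by apply: aK => j /Ka; rewrite oppr_eq0.
  by under eq_bigr do rewrite scaleNr; rewrite sumrN a0 oppr0.
move=> aK a0 i; rewrite leNgt; apply/negP => ai.
pose P := [set j | 0 < a j]%SET; pose S := [set j | a j != 0]%SET.
have SP : P \subset S by apply/fintype.subsetP => j; rewrite !inE => /gt_eqF->.
have DS : S \in comb F by apply: aK => j; rewrite inE.
have DP : P \in comb F by apply: aK => j; rewrite inE => /gt_eqF->.
have ig : i \in qf_gens F.
  have : S \in comb F by [].
  rewrite inE => /andP[/fintype.subsetP Sg _]; apply: Sg.
  by rewrite inE lt_eqF.
have : i \notin P by rewrite inE -leNgt ltW.
apply/negP/negPn; apply: (qf_gens_mem qF) => //.
have [FS FP] : qf_cones F (cone (qf_calib F) S) /\ qf_cones F (cone (qf_calib F) P).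
  by split; [move: DS|move: DP]; rewrite inE => /andP[_ /asboolP].
have [[u [u0 e]] _] := qf_inter qF FS FP.
have uP j : j \in P -> (u *m col j (qf_calib F)) 0 0 = 0.
  move=> jP; suff: (cone (qf_calib F) S `&` cone (qf_calib F) P)
    (col j (qf_calib F)) by rewrite e => -[].
  by split; [apply/col_cone/(fintype.subsetP SP)|exact: col_cone].
suff ui : (u *m col i (qf_calib F)) 0 0 = 0.
  suff [] : (cone (qf_calib F) S `&` cone (qf_calib F) P)
    (col i (qf_calib F)) by [].
  by rewrite e; split=> //; apply: col_cone; rewrite inE lt_eqF.
have /(congr1 (fun x => - (u *m x) 0 0)) := a0.
rewrite linform_col mulmx0 mxE oppr0 -sumrN => /psumr_eq0P z.
have /z /(_ i isT) /eqP : forall j, true -> 0 <= - (a j * (u *m col j (qf_calib F)) 0 0).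
  move=> j _; have [aj|aj|->] := ltgtP (a j) 0; last by rewrite mul0r oppr0.
    rewrite -mulNr; apply: mulr_ge0; first by rewrite oppr_ge0 ltW.
    by apply/u0/col_cone; rewrite inE lt_eqF.
  by rewrite uP ?mulr0 ?oppr0 // inE.
by rewrite oppr_eq0 mulf_eq0 lt_eqF //= => /eqP.
Qed.

(** [B] plays the role of a dual basis on [S]; the face on [K] is cut out by the
    sum of the dual forms of the elements of [S] outside [K]. *)
Lemma is_face_simplicial d n (h : 'M[R]_(d, n)) (S K : {set 'I_n}) (B : 'M[R]_(n, d)) :
  (forall i j, i \in S -> j \in S -> (B *m h) i j = (i == j)%:R) -> K \subset S ->
  is_face (cone h S) (cone h K).
Proof.
move=> BE KS; exists (\sum_(i in S :\: K) row i B)%SET.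
have uE j : j \in S -> ((\sum_(i in S :\: K) row i B)%SET *m col j h) 0 0 = (j \notin K)%:R.
  move=> jS; rewrite mulmx_suml summxE.
  have e i : (row i B *m col j h) 0 0 = (B *m h) i j.
    by rewrite colE mulmxA -row_mul -colE !mxE.
  have [jK|jK] /= := boolP (j \in K).
    rewrite big1 // => i /finset.setDP[iS iK]; rewrite e BE //; case: eqP => // ij.
    by rewrite ij jK in iK.
  rewrite (bigD1 j) ?inE ?jK //= e BE // eqxx.
  rewrite big1 ?addr0 // => i /andP[/finset.setDP[iS _] ij].
  by rewrite e BE // (negbTE ij).
split=> [x [a [a0 ->]]|].
  rewrite linform_col; apply: sumr_ge0 => i iS; rewrite uE // mulr_ge0 //.
apply/seteqP; split=> x /=.
  move=> xK; split; first exact: cone_sub xK.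
  have [a [_ ->]] := xK; rewrite linform_col big1 // => i iK.
  by rewrite uE ?(fintype.subsetP KS) // iK mulr0.
move=> [[a [a0 ->]]]; rewrite linform_col => /psumr_eq0P z.
exists a; split=> //; rewrite (finset.big_setID K) /= (finset.setIidPr KS).
rewrite [X in _ + X]big1 ?addr0 // => i /finset.setDP[iS iK].
have := z _ i iS; rewrite uE // iK mulr1 => ->; first by rewrite scale0r.
by move=> j jS; rewrite uE // mulr_ge0.
Qed.

End Cones.

(** * The block matrices H *)

Section SymGroup.
Context {n : nat} (D : {set {set 'I_n}}) (I : {set 'I_n}).
Hypothesis virtI : I \subset (~: rays D)%SET.
Local Notation J := (free_gens D I).
Local Notation disj A B := (fintype.disjoint (mem A) (mem B)).
Implicit Types (S : {set 'I_n}) (g : sym_group D I) (i j k : 'I_n).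

Lemma virt_ray i : i \in I -> i \in rays D -> False.
Proof. by move=> /(fintype.subsetP virtI); rewrite finset.in_setC => /negP. Qed.

Lemma disj_rays_virt : disj (rays D) I.
Proof. by rewrite disjoint_sym finset.disjoints_subset. Qed.

Lemma disj_rays_free : disj (rays D) J.
Proof.
by rewrite -finset.setI_eq0 /free_gens finset.setCU finset.setIA finset.setICr finset.set0I.
Qed.

Lemma disj_virt_free : disj I J.
Proof.
by rewrite -finset.setI_eq0 /free_gens finset.setCU finset.setICA finset.setICr finset.setI0.
Qed.

Lemma free_gensE j : (j \in J) = (j \notin rays D) && (j \notin I).
Proof. by rewrite !inE negb_or. Qed.

Lemma col_perm_block S (t : {perm 'I_n}) j :
  col j (perm_block S t) = (j \in S)%:R *: delta_mx (t j) 0.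
Proof. by apply/matrixP => i k; rewrite !mxE ord1 andbT -mulnb natrM. Qed.

Lemma col_mul_tr_incl p S (A : 'M[int]_(p, #|S|)) j :
  j \notin S -> col j (A *m (incl_mx S)^T) = 0.
Proof.
move=> jS; apply/matrixP => i k; rewrite !mxE big1 // => l _.
by rewrite !mxE; case: eqP => [e|]; rewrite ?mulr0 //; rewrite e enum_valP in jS.
Qed.

Lemma col_Hmx_ray g j : j \in rays D -> col j (Hmx g) = delta_mx (tau g j) 0.
Proof.
move=> jR; rewrite /Hmx !raddfD /= !col_perm_block !col_mul_tr_incl.
- by rewrite jR (disjointFr disj_rays_virt jR) scale1r scale0r !addr0.
- by rewrite (disjointFr disj_rays_free jR).
- by rewrite (disjointFr disj_rays_free jR).
Qed.

Lemma col_Hmx_virt g j : j \in I -> col j (Hmx g) = delta_mx (sigma g j) 0.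
Proof.
move=> jI; rewrite /Hmx !raddfD /= !col_perm_block !col_mul_tr_incl.
- by rewrite jI (disjointFl disj_rays_virt jI) scale1r scale0r !add0r.
- by rewrite (disjointFr disj_virt_free jI).
- by rewrite (disjointFr disj_virt_free jI).
Qed.

Lemma incl_mx_mul_out S p (A : 'M[int]_(#|S|, p)) i (j : 'I_p) :
  i \notin S -> (incl_mx S *m A) i j = 0.
Proof.
move=> iS; rewrite mxE big1 // => l _.
by rewrite mxE; case: eqP => [e|]; rewrite ?mul0r //; rewrite e enum_valP in iS.
Qed.

Lemma tau_ray g j : (tau g j \in rays D) = (j \in rays D).
Proof. by have [/poset_aut_perm_on t _ _] := sym_groupP g; exact: perm_closed. Qed.

Lemma sigma_virt g j : (sigma g j \in I) = (j \in I).
Proof. by have [_ _ s] := sym_groupP g; exact: perm_closed. Qed.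

Lemma Hmx_nonvirt g i j : j \notin I -> i \in I -> Hmx g i j = 0.
Proof.
move=> jI iI; have [jR|jR] := boolP (j \in rays D).
  have := congr1 (fun A : 'cV_n => A i 0) (col_Hmx_ray g jR); rewrite !mxE => ->.
  case: eqP => // e; have := virt_ray iI; rewrite e tau_ray jR => /(_ isT) [].
have iR : i \notin rays D by rewrite (disjointFl disj_rays_virt iI).
have iJ : i \notin J by rewrite (disjointFr disj_virt_free iI).
rewrite /Hmx -!mulmxA mxE [X in X + _]mxE [X in X + _ + _]mxE !incl_mx_mul_out //.
by rewrite !mxE (negbTE jI) (negbTE jR) !addr0.
Qed.

Lemma incl_mx_tr S : incl_mx S *m (incl_mx S)^T = perm_block S 1.
Proof.
apply/matrixP => i j; rewrite [RHS]mxE perm1.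
have [jS|jS] := boolP (j \in S); last first.
  by have := congr1 (fun A : 'cV_n => A i 0) (col_mul_tr_incl (incl_mx S) jS); rewrite !mxE.
have rK := enum_rankK_in jS jS.
rewrite mxE (bigD1 (enum_rank_in jS j)) //= !mxE rK eqxx mulr1.
rewrite big1 ?addr0 // => l lj; rewrite !mxE; case: (j =P _) => [e|]; last by rewrite mulr0.
by case/eqP: lj; apply: enum_val_inj; rewrite rK.
Qed.

Lemma incl_mx_sum :
  incl_mx (rays D) *m (incl_mx (rays D))^T + incl_mx J *m (incl_mx J)^T
  + incl_mx I *m (incl_mx I)^T = 1%:M :> 'M[int]_n.
Proof.
rewrite !incl_mx_tr; apply/matrixP => i j; rewrite !mxE perm1 free_gensE.
have := @virt_ray j; case: (j \in I) => [/(_ isT)|_]; case: (j \in rays D) => //.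
- by move=> /(_ isT) [].
- by rewrite !add0r.
- by rewrite !addr0.
- by rewrite addr0 add0r.
Qed.

Lemma Hmx1 : Hmx (1%g : sym_group D I) = 1%:M.
Proof.
rewrite -incl_mx_sum !incl_mx_tr /Hmx /tau /sigma /alpha /gl /=.
by rewrite mulmx0 mul0mx mulmx1 addr0 incl_mx_tr.
Qed.

Lemma Hmx_unit g : Hmx g \in unitmx.
Proof.
by have := HmxM g (g^-1)%g virtI; rewrite mulgV Hmx1 => /esym/mulmx1_unit[].
Qed.

Lemma HmxV g : invmx (Hmx g) = Hmx g^-1%g.
Proof.
have := HmxM g (g^-1)%g virtI; rewrite mulgV Hmx1 => e.
by rewrite -[RHS](mulKmx (Hmx_unit g)) -e mulmx1.
Qed.

Lemma Hmx_block_alpha g : (incl_mx (rays D))^T *m Hmx g *m incl_mx J = alpha g.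
Proof.
have [/poset_aut_perm_on t1 _ s1] := sym_groupP g.
rewrite /Hmx !mulmxDr !mulmxDl !mulmxA incl_mxK (incl_mx_disj disj_rays_free).
rewrite -!mulmxA incl_mxK perm_block_incl_disj ?disj_rays_free //.
rewrite perm_block_incl_disj ?disj_virt_free //.
by rewrite !mul0mx !mulmx0 !mulmx1 !mul1mx add0r !addr0.
Qed.

Lemma Hmx_block_gl g : (incl_mx J)^T *m Hmx g *m incl_mx J = gl g.
Proof.
have [/poset_aut_perm_on t1 _ s1] := sym_groupP g.
have dJR : disj J (rays D) by rewrite disjoint_sym disj_rays_free.
rewrite /Hmx !mulmxDr !mulmxDl !mulmxA incl_mxK (incl_mx_disj dJR).
rewrite -!mulmxA incl_mxK perm_block_incl_disj ?disj_rays_free //.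
rewrite perm_block_incl_disj ?disj_virt_free //.
by rewrite !mul0mx !mulmx0 !mulmx1 !mul1mx !add0r !addr0.
Qed.

Lemma delta_cV_inj (K : nzRingType) i j : delta_mx i 0 = delta_mx j 0 :> 'cV[K]_n -> i = j.
Proof.
move=> /matrixP/(_ i 0); rewrite !mxE eqxx /=; case: eqP => // _ /eqP.
by rewrite oner_eq0.
Qed.

Lemma Hmx_inj : injective (@Hmx n D I).
Proof.
move=> g g' e; have [/poset_aut_perm_on t1 _ s1] := sym_groupP g.
have [/poset_aut_perm_on t2 _ s2] := sym_groupP g'.
apply: sym_group_eq.
- apply/permP => j; have [jR|jR] := boolP (j \in rays D); last by rewrite !(out_perm _ jR).
  by apply: (@delta_cV_inj int); rewrite -!col_Hmx_ray ?e.
- by rewrite -!Hmx_block_alpha e.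
- by rewrite -!Hmx_block_gl e.
- apply/permP => j; have [jI|jI] := boolP (j \in I); last by rewrite !(out_perm _ jI).
  by apply: (@delta_cV_inj int); rewrite -!col_Hmx_virt ?e.
Qed.

(** Extending by the identity outside [S] gives an injective map of the whole index
    set, since an invertible matrix has distinct columns. *)
Lemma maps_generators_perm (H : 'M[int]_n) (S : {set 'I_n}) :
  H \in unitmx -> maps_generators H S S ->
  exists2 t : {perm 'I_n}, perm_on S t & forall i, i \in S -> col i H = delta_mx (t i) 0.
Proof.
move=> uH HS; have [i|f fP] := @boolp.choice _ _ (fun i k => is_true (if i \in S then
    (k \in S) && (col i H == delta_mx k 0) else k == i)).
   have [/HS[k kS /eqP e]|_] := boolP (i \in S); last by exists i.
  by exists k; rewrite kS.
have fS i : (f i \in S) = (i \in S).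
  by have := fP i; case: ifPn => [_ /andP[]|iS /eqP->]; rewrite ?(negbTE iS).
have f_inj : injective f.
  move=> i j e; have := fS i; rewrite e fS => /esym ij.
  have := fP i; have := fP j; rewrite ij; case: ifP => _; last first.
    by move=> /eqP <- /eqP <-.
  move=> /andP[_ /eqP ej] /andP[_ /eqP ei]; apply: (@delta_cV_inj int).
  by apply: (can_inj (mulKmx uH)); rewrite -!colE ei ej e.
exists (perm f_inj).
  apply/fintype.subsetP => i; rewrite inE permE => fi.
  by have := fP i; case: ifP => // _; rewrite (negbTE fi).
by move=> i iS; rewrite permE; have := fP i; rewrite iS => /andP[_ /eqP].
Qed.

(** The block decomposition of an invertible H with the properties of an
    isomorphism of fans.  Only the invertibility of the free block needs the
    inverse matrix: the rows of [invmx H] indexed by free generators vanish on rays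
    and virtual generators, so the free blocks of H and of its inverse are inverse
    to each other. *)
Lemma Hmx_surj (H : 'M[int]_n) :
  H \in unitmx -> maps_generators H (rays D) (rays D) -> maps_generators H I I ->
  maps_generators (invmx H) (rays D) (rays D) ->
  maps_generators (invmx H) I I ->
  (forall i j, j \notin I -> i \in I -> H i j = 0) ->
  (forall t : {perm 'I_n}, perm_on (rays D) t ->
     (forall i, i \in rays D -> col i H = delta_mx (t i) 0) -> t \in poset_aut D) ->
  exists g, Hmx g = H.
Proof.
move=> uH HR HI VR VI H0 Hp.
have [t tR te] := maps_generators_perm uH HR.
have [s sI se] := maps_generators_perm uH HI.
pose E := incl_mx (rays D); pose F := incl_mx J; pose G := incl_mx I.
have FV : F^T *m invmx H = F^T *m invmx H *m F *m F^T.
  have z S : disj S J -> maps_generators (invmx H) S S ->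
      F^T *m invmx H *m incl_mx S = 0.
    move=> dS h; apply/matrixP => a b; rewrite -mulmxA tr_incl_mulE mxE.
    have /h[k kS /matrixP e] := enum_valP b.
    rewrite mxE (bigD1 (enum_val b)) //= !mxE eqxx mulr1 big1 ?addr0.
      have := e (enum_val a) 0; rewrite !mxE => ->; case: eqP => // e'.
      by have := disjointFr dS kS; rewrite -e' enum_valP.
    by move=> c cb; rewrite !mxE (negbTE cb) mulr0.
  rewrite -[LHS]mulmx1 -incl_mx_sum !mulmxDr !mulmxA.
  have zE : F^T *m invmx H *m E = 0 by exact: z disj_rays_free VR.
  have zG : F^T *m invmx H *m G = 0 by exact: z disj_virt_free VI.
  by rewrite zE zG !mul0mx add0r addr0.
have uA : F^T *m H *m F \in unitmx.
  have : (F^T *m invmx H *m F) *m (F^T *m H *m F) = 1%:M.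
    by rewrite !mulmxA -FV mulmxKV // incl_mxK.
  by move=> /mulmx1_unit[].
have gP : sym_pred (t, E^T *m H *m F, F^T *m H *m F, s).
  by rewrite /= uA sI Hp.
exists (exist (fun x => is_true (sym_pred x)) _ gP).
have colP (A B : 'M[int]_n) : (forall j, col j A = col j B) -> A = B.
  by move=> e; apply/matrixP => i j; have /matrixP/(_ i 0) := e j; rewrite !mxE.
apply: colP => j.
have [jR|jR] := boolP (j \in rays D); first by rewrite col_Hmx_ray // te.
have [jI|jI] := boolP (j \in I); first by rewrite col_Hmx_virt // se.
have jJ : j \in J by rewrite free_gensE jR.
rewrite /Hmx !raddfD /= !col_perm_block (negbTE jR) (negbTE jI) !scale0r addr0 add0r.
rewrite -raddfD /= -mulmxDl /alpha /gl /= !mulmxA -!mulmxDl.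
have -> : E *m E^T + F *m F^T = 1%:M - G *m G^T by rewrite -incl_mx_sum addrK.
have GH : G^T *m H *m F = 0.
  apply/matrixP => a b; rewrite -mulmxA tr_incl_mulE !mxE big1 // => k _.
  rewrite mxE; case: eqP => [->|]; last by rewrite mulr0.
  rewrite H0 ?mul0r ?enum_valP //.
  by rewrite (disjointFl disj_virt_free) ?enum_valP.
rewrite !mulmxBl mul1mx -(mulmxA G _ H) -(mulmxA G _ F) GH mulmx0 mul0mx subr0.
by rewrite -mulmxA incl_mx_tr colE -mulmxA -colE col_perm_block jJ scale1r perm1 -colE.
Qed.

End SymGroup.

(** * Admissible calibrations and isomorphisms of fans *)

Section Admissible.
Context {R : realType} {d n : nat} (D : {set {set 'I_n}}) (I : {set 'I_n}).
Implicit Types (h : 'M[R]_(d, n)) (L : 'M[R]_d) (K : {set 'I_n}) (t : {perm 'I_n}).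

Lemma admissible_sub_rays h : admissible D I h -> {in D, forall K, K \subset rays D}.
Proof. by move=> [_ cD] K; rewrite -{1}cD inE => /andP[]. Qed.

(** A poset automorphism is determined by its action on singletons, since a set
    K in D is the union of the singletons below it. *)
Lemma poset_aut_imset t K : {in D, forall K, K \subset rays D} ->
  t \in poset_aut D -> K \in D -> (t @: K)%SET \in D.
Proof.
move=> DR /poset_autP[ot [phi [phi_sub phi1]]] KD.
have {}phi1 j (jD : [set j]%SET \in D) :
    val (phi (exist (fun S => is_true (S \in D)) _ jD)) = [set t j]%SET.
  exact: phi1.
pose x : {S : {set 'I_n} | S \in D} := exist _ K KD.
suff -> : (t @: K)%SET = val (phi x) by exact: valP.
have memV i : i \in rays D -> (t i \in val (phi x)) = (i \in K).
  rewrite inE => iD; rewrite -!finset.sub1set -(phi1 _ iD) phi_sub //.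
apply/setP => i; rewrite -[i in LHS](permKV t) mem_imset; last exact: perm_inj.
have [iR|iR] := boolP ((t^-1)%g i \in rays D).
  by rewrite -memV // permKV.
rewrite (contraNF (fintype.subsetP (DR _ KD) _) iR).
rewrite perm_on_memV // in iR.
by rewrite (contraNF (fintype.subsetP (DR _ (valP (phi x))) _) iR).
Qed.

Lemma is_face_unitmx L (s t : set 'cV[R]_d) : L \in unitmx -> is_face s t ->
  is_face [set x | s (invmx L *m x)] [set x | t (invmx L *m x)].
Proof.
move=> uL [u [u0 ->]]; exists (u *m invmx L); split=> [x /= /u0|].
  by rewrite mulmxA.
by apply/seteqP; split=> x /=; rewrite mulmxA.
Qed.

Lemma is_ray_unitmx L (s : set 'cV[R]_d) : L \in unitmx -> is_ray s ->
  is_ray [set x | s (invmx L *m x)].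
Proof.
move=> uL [v v0 ->]; exists (L *m v).
  by apply: contra_neq v0 => e; rewrite -(mulKmx uL v) e mulmx0.
apply/seteqP; split=> x /= [a a0 e]; exists a => //.
  by rewrite -(mulKVmx uL x) e scalemxAr.
by rewrite e -scalemxAr mulKmx.
Qed.

Lemma preimage_invmxK L (s : set 'cV[R]_d) : L \in unitmx ->
  [set x | [set y | s (invmx L *m y)] (L *m x)] = s.
Proof. by move=> uL; apply/seteqP; split=> x /=; rewrite mulKmx. Qed.

(** Every clause of the definition of a fan is invariant under a linear
    automorphism L; the new cones are the images of the old ones, written as
    preimages under the inverse of L. *)
Lemma admissible_mulmx L h : L \in unitmx -> admissible D I h ->
  admissible D I (L *m h).
Proof.
move=> uL [qF cD]; pose pL (s : set 'cV[R]_d) := [set x | s (invmx L *m x)].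
have cE K : cone (L *m h) K = pL (cone h K) by exact: cone_unitmx.
have uV : invmx L \in unitmx by rewrite unitmx_inv.
have pLK s : [set x | pL s (L *m x)] = s by exact: preimage_invmxK.
have pLV s : pL [set x | s (L *m x)] = s.
  by apply/seteqP; split=> x; rewrite /pL /= mulKVmx.
have pL_inj : injective pL by move=> s s' e; rewrite -[s]pLK e pLK.
have conesE s : qf_cones (fan_of D I (L *m h)) (pL s) <-> qf_cones (fan_of D I h) s.
  split=> /= -[K KD e]; exists K => //; last by rewrite e cE.
  by apply: pL_inj; rewrite e cE.
split; last first.
  rewrite -[RHS]cD; apply/setP => K; rewrite !inE; congr andb.
  by apply: asbool_equiv_eq; rewrite /qf_calib /= cE; exact: conesE.
have conesP s : qf_cones (fan_of D I (L *m h)) s ->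
    exists2 s', s = pL s' & qf_cones (fan_of D I h) s'.
  move=> Fs; exists [set x | s (L *m x)]; first by rewrite pLV.
  by apply: (conesE _).1; rewrite pLV.
split=> //.
- rewrite [qf_cones _](_ : _ = pL @` qf_cones (fan_of D I h)).
    by apply: finite_image; exact: qf_finite qF.
  apply/seteqP; split=> s; first by move=> /conesP[s' -> Fs']; exists s'.
  by move=> [s' /conesE Fs' <-].
- move=> _ /conesP[s -> /(qf_polyhedral qF)[k [g ->]]]; exists k, g.
  by rewrite /= -mulmxA; apply/esym/cone_unitmx.
- move=> _ /conesP[s -> Fs] x sx sNx.
  have : invmx L *m x = 0.
    by apply: (qf_strongly_convex qF Fs) => //; rewrite -mulmxN.
  by move=> e; rewrite -(mulKVmx uL x) e mulmx0.
- have -> : [set 0] = pL [set 0].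
    apply/seteqP; split=> x /= [e]; first by rewrite /pL /= e mulmx0.
    by rewrite -(mulKVmx uL x) e mulmx0.
  exact/conesE/(qf_zero qF).
- move=> _ t /conesP[s -> Fs] /(is_face_unitmx uV).
  rewrite invmxK pLK -{2}[t]pLV => /(qf_face qF Fs) Ft; exact/conesE.
- move=> _ _ /conesP[s -> Fs] /conesP[t -> Ft].
  have [h1 h2] := qf_inter qF Fs Ft.
  by split; [exact: (is_face_unitmx uL h1)|exact: (is_face_unitmx uL h2)].
- apply/spanningP => x.
  have [v [v0 e]] := (spanningP _ _).1 (qf_span qF) (invmx L *m x).
  by exists v; split=> //; rewrite -mulmxA -e mulKVmx.
- apply/spanningP => x.
  have [v [v0 e]] := (spanningP _ _).1 (qf_virt_span qF) (invmx L *m x).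
  by exists v; split=> //; rewrite -mulmxA -e mulKVmx.
- exact: qf_gens_nonvirt qF.
- move=> i /(qf_gens_ray qF)[Fi ri]; rewrite /qf_calib /= cE; split.
    exact/conesE.
  exact: is_ray_unitmx.
- move=> i j ig jg; rewrite /qf_calib /= !cE => /pL_inj; exact: (qf_gens_inj qF).
- move=> _ /conesP[s -> Fs] /(is_ray_unitmx uV).
  by rewrite invmxK pLK => /(qf_ray_gens qF Fs)[i ig ->]; exists i; rewrite //= cE.
Qed.

Hypothesis virtI : I \subset (~: rays D)%SET.
Implicit Types g : sym_group D I.

Lemma col_mul_intmx (H : 'M[int]_n) (h : 'M[R]_(d, n)) i k : col i H = delta_mx k 0 ->
  col i (h *m intmx H) = col k h.
Proof.
move=> e; apply: colM_delta; rewrite /intmx -map_col e.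
by apply/matrixP => a b; rewrite !mxE; case: (_ && _); rewrite ?mulr1z ?mulr0z.
Qed.

Lemma cone_Hmx g (h : 'M[R]_(d, n)) K : K \subset rays D ->
  cone h (tau g @: K)%SET = cone (h *m intmx (Hmx g)) K.
Proof.
move=> KR; apply: cone_perm => i iK; rewrite (col_mul_intmx _ (col_Hmx_ray virtI g _)) //.
exact: fintype.subsetP KR _ iK.
Qed.

(** The calibrations h and h H have the same cones, because H permutes the rays
    by an automorphism of D; only the labels of the generators change.  For the
    span of the non-virtual generators, H maps the coordinate subspace of the
    non-virtual indices into itself. *)
Lemma admissible_Hmx g h : admissible D I (h *m intmx (Hmx g)) -> admissible D I h.
Proof.
set h' := h *m _ => ah; have DR := admissible_sub_rays ah.
have [t1 _ _] := sym_groupP g; have [qF cD] := ah.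
have tD K : K \in D -> (tau g @: K)%SET \in D by exact: poset_aut_imset.
have tDV K : K \in D -> ((tau g)^-1%g @: K)%SET \in D.
  by apply: poset_aut_imset => //; exact: poset_autV.
have tK K : (tau g @: ((tau g)^-1%g @: K))%SET = K.
  by rewrite -imset_comp (eq_imset (g := id)) ?imset_id // => i /=; rewrite permKV.
have VR K : K \subset rays D -> ((tau g)^-1%g @: K)%SET \subset rays D.
  move=> KR; apply/fintype.subsetP => _ /imsetP[i iK ->].
  by rewrite -(tau_ray g) permKV (fintype.subsetP KR).
have cE K : K \subset rays D -> cone h K = cone h' ((tau g)^-1%g @: K)%SET.
  by move=> KR; rewrite -cone_Hmx ?tK ?VR.
have conesE : qf_cones (fan_of D I h) = qf_cones (fan_of D I h').
  apply/seteqP; split=> s /= [K KD ->].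
    by exists ((tau g)^-1%g @: K)%SET; [exact: tDV|apply/cE/DR].
  by exists (tau g @: K)%SET; [exact: tD|rewrite cone_Hmx ?DR].
have c1 i : i \in rays D -> cone h [set i]%SET = cone h' [set (tau g)^-1%g i]%SET.
  by move=> iR; rewrite cE ?finset.sub1set // imset_set1.
have tVR i : i \in rays D -> (tau g)^-1%g i \in rays D.
  by move=> iR; rewrite -(tau_ray g) permKV.
split; last first.
  apply/setP => K; rewrite inE; apply/andP/idP => [[KR /asboolP]|KD].
    rewrite conesE /qf_calib /= cE // => -[K' K'D e].
    rewrite -(tK K); apply: tD.
    suff: ((tau g)^-1%g @: K)%SET \in comb (fan_of D I h') by rewrite {1}cD.
    by rewrite inE VR //=; apply/asboolP; exists K'.
  by split; [exact: DR|apply/asboolP; exists K].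
split; rewrite ?conesE.
- exact: qf_finite qF.
- move=> s /(qf_polyhedral qF)[k [w ->]]; exists k, (Hmx g *m w).
  by rewrite intmxM mulmxA.
- exact: qf_strongly_convex qF.
- exact: qf_zero qF.
- exact: qf_face qF.
- exact: qf_inter qF.
- apply/spanningP => x.
  have [v [v0 e]] := (spanningP _ _).1 (qf_span qF) x.
  exists (intmx (Hmx g) *m v); split; last by rewrite mulmxA.
  by move=> i; rewrite finset.in_setT.
- apply/spanningP => x.
  have [v [v0 e]] := (spanningP _ _).1 (qf_virt_span qF) x.
  exists (intmx (Hmx g) *m v); split; last by rewrite mulmxA.
  move=> i iI; rewrite mxE big1 // => j _.
  have [jI|jI] := boolP (j \in I); first by rewrite v0 ?mulr0 // !inE jI.
  by rewrite mxE Hmx_nonvirt ?mul0r //; rewrite !inE negbK in iI.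
- exact: qf_gens_nonvirt qF.
- by move=> i iR; rewrite /qf_calib /= c1 //; apply: (qf_gens_ray qF); exact: tVR.
- move=> i j iR jR; rewrite /qf_calib /= !c1 // => e; apply: (@perm_inj _ (tau g)^-1%g).
  by apply: (qf_gens_inj qF) => //; exact: tVR.
- move=> s Fs /(qf_ray_gens qF Fs)[i iR ->]; exists (tau g i); rewrite ?tau_ray //=.
  by rewrite c1 ?tau_ray // permK.
Qed.

Lemma iso_half_Hmx g h h' L : {in D, forall K, K \subset rays D} ->
  L *m h = h' *m intmx (Hmx g) ->
  quantum_fan_iso_half (fan_of D I h) (fan_of D I h') L (Hmx g).
Proof.
move=> DR e; have [t1 _ _] := sym_groupP g; split.
- split=> //=.
  + move=> s [K KD ->]; exists (cone h' (tau g @: K)%SET).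
      by exists (tau g @: K)%SET => //; exact: poset_aut_imset.
    by move=> x; rewrite cone_Hmx ?DR // -e; exact: cone_mulmx.
  + move=> i iI k; have /matrixP/(_ k 0) := col_Hmx_virt virtI g iI.
    rewrite !mxE eqxx andbT => ->; split; first by case: (_ == _).
    by case: eqP => // ->; rewrite sigma_virt iI.
  + by move=> j jI k kI; rewrite Hmx_nonvirt.
- by move=> i iR; exists (tau g i); rewrite ?tau_ray // col_Hmx_ray.
- by move=> i iI; exists (sigma g i); rewrite ?sigma_virt // col_Hmx_virt.
Qed.

Lemma iso_Hmx g h h' L : {in D, forall K, K \subset rays D} -> L \in unitmx ->
  L *m h = h' *m intmx (Hmx g) ->
  quantum_fan_iso (fan_of D I h) (fan_of D I h') L (Hmx g).
Proof.
move=> DR uL e; split=> //; first exact: Hmx_unit.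
  exact: iso_half_Hmx.
rewrite HmxV //; apply: iso_half_Hmx => //.
apply: (can_inj (mulKmx uL)); rewrite mulKVmx // mulmxA e -mulmxA -intmxM.
by rewrite -HmxM // mulgV Hmx1 // intmx1 mulmx1.
Qed.

(** The permutation t of the rays given by H is an automorphism of D.  Take K in D,
    with cone s.  Then L s lies in a cone s' of the second fan, and the inverse of
    L sends s' into a cone s'' of the first one.  Since s is a face of s'', pulling
    back the linear form shows that L s is a face of s', hence a cone of the
    second fan; its generators are those with indices in t(K). *)
Lemma iso_HmxP h h' L H : admissible D I h -> admissible D I h' ->
  quantum_fan_iso (fan_of D I h) (fan_of D I h') L H ->
  exists g, Hmx g = H.
Proof.
move=> ah ah' [uL uH [m HR HI] [m' VR VI]].
have DR := admissible_sub_rays ah; have [qF cD] := ah; have [qF' cD'] := ah'.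
apply: (Hmx_surj virtI) => //; first by move=> i j jI iI; exact: (mor_nonvirt m).
move=> t ot te; suff tD K : K \in D -> (t @: K)%SET \in D.
  apply/poset_autP; split=> //.
  pose f (x : {K | K \in D}) : {K | K \in D} :=
    exist (fun S => is_true (S \in D)) _ (tD _ (valP x)).
  have f_inj : injective f.
    by move=> x y /(congr1 val) /= /(imset_inj (@perm_inj _ t)) /val_inj.
  exists (perm f_inj); split=> [x y|x i xE]; rewrite !permE /=.
    apply/idP/idP; last exact: imsetS.
    move=> /fintype.subsetP xy; apply/fintype.subsetP => i ix.
    by rewrite -(mem_imset _ _ (@perm_inj _ t)) xy ?imset_f.
  by rewrite xE imset_set1.
move=> KD; have KR := DR _ KD.
have e : cone h' (t @: K)%SET = cone (L *m h) K.
  apply: cone_perm => i iK; rewrite (mor_calib m) (col_mul_intmx _ (te i _)) //.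
  exact: fintype.subsetP KR _ iK.
have tKR : (t @: K)%SET \subset rays D.
  apply/fintype.subsetP => _ /imsetP[i iK ->].
  by rewrite perm_closed // (fintype.subsetP KR).
suff: (t @: K)%SET \in comb (fan_of D I h') by rewrite cD'.
rewrite inE tKR /=; apply/asboolP; rewrite e.
have FK : qf_cones (fan_of D I h) (cone h K) by exists K.
have [s' Fs' Ks'] := mor_cones m FK; have [s'' Fs'' ss''] := mor_cones m' Fs'.
apply: (qf_face qF' Fs'); have [[u [u0 fK]] _] := qf_inter qF Fs'' FK.
have Ks'' : cone h K `<=` s''.
  by move=> x xK; rewrite -(mulKmx uL x); apply/ss''/Ks'.
exists (u *m invmx L); split=> [x /ss''/u0|]; first by rewrite mulmxA.
rewrite cone_unitmx //; apply/seteqP; split=> x /=.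
  move=> xK; split; first by rewrite -(mulKVmx uL x); exact: Ks'.
  have : (s'' `&` cone h K) (invmx L *m x) by split=> //; exact: Ks''.
  by rewrite fK => -[_]; rewrite mulmxA.
move=> [s'x ux]; suff [] : (s'' `&` cone h K) (invmx L *m x) by [].
by rewrite fK; split; [exact: ss''|rewrite mulmxA].
Qed.

End Admissible.

(** * Normalized calibrations and the action on Omega(D) *)

Section Normalize.
Context {R : realType} {d m : nat} (D : {set {set 'I_(d + m)}}) (I : {set 'I_(d + m)}).
Implicit Types (h : 'M[R]_(d, d + m)) (w : 'M[R]_(d, m)) (L : 'M[R]_d).
Local Notation base := [set lshift m i | i : 'I_d]%SET.

(** In a simplicial cone every set of generators spans a face; the inverse of the
    block of the first d columns supplies the dual basis. *)
Lemma sub_simplicial_comb (F : quantum_fan R d (d + m)) (K : {set 'I_(d + m)}) :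
  is_quantum_fan F -> lsubmx (qf_calib F) \in unitmx ->
  base \in comb F -> K \subset base -> K \in comb F.
Proof.
move=> qF uF; rewrite !inE => /andP[Bg /asboolP FB] KB.
rewrite (fintype.subset_trans KB Bg) /=; apply/asboolP.
apply: (qf_face qF FB).
apply: (@is_face_simplicial _ _ _ _ _ _ (col_mx (invmx (lsubmx (qf_calib F))) 0)) => //.
move=> _ _ /imsetP[i _ ->] /imsetP[j _ ->].
rewrite mul_col_mx col_mxEu (inj_eq (@lshift_inj _ _)).
have := mulVmx uF; move=> /matrixP/(_ i j); rewrite !mxE => <-.
by apply: eq_bigr => k _; rewrite !mxE.
Qed.

Hypothesis baseD : forall K : {set 'I_(d + m)}, K \subset base -> K \in D.

(** The first d generators are linearly independent whatever the fan of type D,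
    since all sets of them are cones. *)
Lemma admissible_lsubmx h : admissible D I h -> lsubmx h \in unitmx.
Proof.
move=> [qF cD]; rewrite -unitmx_tr -row_free_unit; apply/inj_row_free => v vh.
pose a (j : 'I_(d + m)) : R := if fintype.split j is inl i then v 0 i else 0.
have aL i : a (lshift m i) = v 0 i by rewrite /a (unsplitK (inl i)).
have aR i : a (rshift d i) = 0 by rewrite /a (unsplitK (inr i)).
suff a0 : forall j, a j = 0 by apply/rowP => i; rewrite mxE -aL a0.
apply: (comb_free qF).
  move=> K Ka; rewrite cD; apply: baseD; apply/fintype.subsetP => j /Ka.
  by case: (split_ordP j) => i -> ; rewrite ?aR ?eqxx // imset_f.
rewrite big_split_ord /= [X in _ + X]big1 ?addr0; last first.
  by move=> i _; rewrite aR scale0r.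
apply/matrixP => i j; rewrite summxE mxE.
have /matrixP/(_ 0 i) := vh; rewrite !mxE => {2}<-.
by apply: eq_bigr => k _; rewrite aL !mxE.
Qed.

Definition normalize h : 'M[R]_(d, m) := rsubmx (invmx (lsubmx h) *m h).

Lemma row_normalize h : lsubmx h \in unitmx ->
  row_mx 1%:M (normalize h) = invmx (lsubmx h) *m h.
Proof.
move=> uh; rewrite -[RHS]hsubmxK; congr row_mx.
by rewrite -[X in _ *m X](hsubmxK h) mul_mx_row row_mxKl mulVmx.
Qed.

Lemma normalize_row w : normalize (row_mx 1%:M w) = w.
Proof. by rewrite /normalize row_mxKl invmx1 mul1mx row_mxKr. Qed.

Lemma normalize_Omega h : admissible D I h -> Omega R D I (normalize h).
Proof.
move=> ah; have uh := admissible_lsubmx ah.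
by rewrite /Omega /= row_normalize //; apply: admissible_mulmx; rewrite ?unitmx_inv.
Qed.

Hypothesis virtI : I \subset (~: rays D)%SET.
Implicit Types g : sym_group D I.

Lemma intmx_Hmx_unit g : intmx (Hmx g) \in (unitmx : pred 'M[R]_(d + m)).
Proof.
have : intmx (Hmx g) *m intmx (Hmx (g^-1)%g) = 1%:M :> 'M[R]_(d + m).
  by rewrite -intmxM -HmxM // mulgV Hmx1 // intmx1.
by move=> /mulmx1_unit[].
Qed.

Lemma base_ray i : lshift m i \in rays D.
Proof. by rewrite inE; apply: baseD; rewrite finset.sub1set imset_f. Qed.

(** The linear map L attached to g and w.  Writing it through h H^-1 makes its
    invertibility a consequence of the admissibility of h H^-1; the description by
    columns of h permuted by [tau g] is [Omega_linear_matrix]. *)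
Definition Omega_linear g w : 'M[R]_d :=
  invmx (lsubmx (row_mx 1%:M w *m invmx (intmx (Hmx g)))).

Lemma Omega_linear_matrix g w : Omega_linear g w = invmx (\matrix_(i < d, j < d)
  (row_mx 1%:M w) i ((tau g)^-1%g (lshift m j))).
Proof.
congr invmx; set h := row_mx _ _; apply/matrixP => i j.
set k := ((tau g)^-1%g (lshift m j)).
have kR : k \in rays D by rewrite -(tau_ray g) permKV base_ray.
have := col_mul_intmx (h *m invmx (intmx (Hmx g))) (col_Hmx_ray virtI g kR).
rewrite mulmxKV ?intmx_Hmx_unit // permKV => /matrixP/(_ i 0).
by rewrite !mxE => <-.
Qed.

Lemma admissible_HmxV g w : Omega R D I w ->
  admissible D I (row_mx 1%:M w *m invmx (intmx (Hmx g))).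
Proof.
by move=> Ow; apply: (admissible_Hmx virtI (g := g)); rewrite mulmxKV ?intmx_Hmx_unit.
Qed.

Lemma Omega_linear_unit g w : Omega R D I w -> Omega_linear g w \in unitmx.
Proof. by move=> Ow; rewrite unitmx_inv; exact/admissible_lsubmx/admissible_HmxV. Qed.

Lemma Omega_actE g w : Omega R D I w ->
  Omega_linear g w *m row_mx 1%:M w = row_mx 1%:M (Omega_act R D I g w) *m intmx (Hmx g).
Proof.
move=> Ow; rewrite /Omega_act -Omega_linear_matrix -mulmxA row_normalize.
  by rewrite /Omega_linear mulmxA mulmxKV // intmx_Hmx_unit.
exact/admissible_lsubmx/admissible_HmxV.
Qed.

(** The first d columns of the equation say that L is inverse to the first block
    of h H^-1; the last columns then compute w'. *)
Lemma Omega_act_unique g w w' L : Omega R D I w ->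
  L *m row_mx 1%:M w = row_mx 1%:M w' *m intmx (Hmx g) ->
  L = Omega_linear g w /\ Omega_act R D I g w = w'.
Proof.
move=> Ow e.
have {e} : L *m (row_mx 1%:M w *m invmx (intmx (Hmx g))) = row_mx 1%:M w'.
  by rewrite mulmxA e mulmxK // intmx_Hmx_unit.
rewrite /Omega_act -Omega_linear_matrix -mulmxA /Omega_linear.
have := admissible_lsubmx (admissible_HmxV g Ow).
set h' := _ *m _; rewrite -{2}(hsubmxK h'); set M := lsubmx h' => uM.
rewrite mul_mx_row => /eq_row_mx[LM LN].
have LE : L = invmx M by rewrite -[L](mulmxK uM) LM mul1mx.
split=> //; rewrite -LE -[h']hsubmxK mul_mx_row row_mxKr; exact: LN.
Qed.

Lemma Omega_act_stable g w : Omega R D I w -> Omega R D I (Omega_act R D I g w).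
Proof.
move=> Ow; rewrite /Omega /=; apply: (admissible_Hmx virtI (g := g)).
rewrite -Omega_actE //; apply: admissible_mulmx => //.
exact: Omega_linear_unit.
Qed.

(** The axioms follow from uniqueness, applied with L = 1 and with the product of
    the linear maps. *)
Lemma Omega_act_group : group_action_on (Omega R D I) (Omega_act R D I).
Proof.
split=> [g w|w Ow|g g' w Ow]; first exact: Omega_act_stable.
  apply: (Omega_act_unique (L := 1%:M) Ow _).2.
  by rewrite Hmx1 // intmx1 mul1mx mulmx1.
have Ow' := Omega_act_stable g' Ow; set w' := Omega_act R D I g' w.
apply: (Omega_act_unique (L := Omega_linear g w' *m Omega_linear g' w) Ow _).2.
by rewrite -mulmxA Omega_actE // mulmxA Omega_actE // HmxM // intmxM mulmxA.
Qed.

End Normalize.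

(** * The equivalence between the two groupoids *)

Section Equivalence.
Context {R : realType} {d m : nat} (D : {set {set 'I_(d + m)}}) (I : {set 'I_(d + m)}).
Hypothesis baseD :
  forall K : {set 'I_(d + m)}, K \subset [set lshift m i | i : 'I_d]%SET -> K \in D.
Hypothesis virtI : I \subset (~: rays D)%SET.
Variable Oact : group_action_on (Omega R D I) (Omega_act R D I).
Implicit Types S T U : manifold R.

Notation P := (moduli_prestack R d D I).
Notation A := (action_prestack Oact).

Lemma smooth_family_locally_constant T p q (X : Type) (g : T -> X) (f : X -> 'M[R]_(p, q)) :
  locally_constant g -> smooth_family (fun t => f (g t)).
Proof.
move=> lg t i j; apply: smooth_at_local (smooth_at_cst t (f (g t) i j)).
by apply: filterS (lg t) => s ->.
Qed.

Lemma locally_constant_map T (X Y : Type) (f : X -> Y) (g : T -> X) :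
  locally_constant g -> locally_constant (fun t => f (g t)).
Proof. by move=> lg t; apply: filterS (lg t) => s ->. Qed.

Lemma smooth_family_row T p q r (M : T -> 'M[R]_(p, q)) (N : T -> 'M[R]_(p, r)) :
  smooth_family M -> smooth_family N -> smooth_family (fun t => row_mx (M t) (N t)).
Proof.
move=> sM sN t i j; case: (split_ordP j) => k jE.
  rewrite (_ : (fun s => _) = fun s => M s i k); first exact: sM.
  by apply/funext => s; rewrite jE row_mxEl.
rewrite (_ : (fun s => _) = fun s => N s i k); first exact: sN.
by apply/funext => s; rewrite jE row_mxEr.
Qed.

Lemma smooth_family_lsub T p q r (M : T -> 'M[R]_(p, q + r)) :
  smooth_family M -> smooth_family (fun t => lsubmx (M t)).
Proof.
move=> sM t i j; rewrite (_ : (fun s => _) = fun s => M s i (lshift r j)); first exact: sM.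
by apply/funext => s; rewrite mxE.
Qed.

Lemma smooth_family_rsub T p q r (M : T -> 'M[R]_(p, q + r)) :
  smooth_family M -> smooth_family (fun t => rsubmx (M t)).
Proof.
move=> sM t i j; rewrite (_ : (fun s => _) = fun s => M s i (rshift q j)); first exact: sM.
by apply/funext => s; rewrite mxE.
Qed.

Lemma smooth_family_normalize T (h : calibration_family d D I T) :
  smooth_family (fun t => normalize (h t)).
Proof.
have sh : smooth_family h by exact: cal_smooth.
apply/smooth_family_rsub/smooth_family_mul => //.
apply: smooth_family_invmx; last exact: smooth_family_lsub.
by move=> t; apply: (admissible_lsubmx baseD); exact: cal_admissible.
Qed.

Lemma smooth_Omega_linear T (g : T -> sym_group D I) (w : point_family (Omega R D I) T) :
  locally_constant g -> smooth_family (fun t => Omega_linear (g t) (w t)).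
Proof.
move=> lg; have sw : smooth_family w by exact: pt_smooth.
apply: smooth_family_invmx.
  by move=> t; apply/(admissible_lsubmx baseD)/admissible_HmxV => //; exact: pt_in.
apply/smooth_family_lsub/smooth_family_mul.
  by apply: smooth_family_row => //; exact: smooth_family_cst.
exact: (smooth_family_locally_constant (fun g0 => invmx (intmx (Hmx g0))) lg).
Qed.

(** The inverse of [Hmx], with an arbitrary value outside its image.  Being a
    function of the matrix alone, it turns locally constant matrices into locally
    constant group elements. *)
Definition matrix_sym (H : 'M[int]_(d + m)) : sym_group D I := xget 1%g [set g | Hmx g = H].

Lemma HmxK g : matrix_sym (Hmx g) = g.
Proof.
rewrite /matrix_sym; case: xgetP => [g' _ /= e|/(_ g)/= []//].
exact: (Hmx_inj virtI e).
Qed.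

Lemma matrix_symK h h' L H : admissible D I h -> admissible D I h' ->
  quantum_fan_iso (fan_of (R:=R) (d:=d) D I h) (fan_of D I h') L H ->
  Hmx (matrix_sym H) = H.
Proof. by move=> ah ah' /(iso_HmxP virtI ah ah')[g <-]; rewrite HmxK. Qed.

Definition calibration_of_point T (w : point_family (Omega R D I) T) :
    calibration_family d D I T :=
  CalibrationFamily
    (smooth_family_row (smooth_family_cst 1%:M) (@pt_smooth _ _ _ _ _ w))
    (fun t => pt_in w t).

Definition point_of_calibration T (h : calibration_family d D I T) :
    point_family (Omega R D I) T :=
  PointFamily (smooth_family_normalize h)
    (fun t => normalize_Omega baseD (cal_admissible h t)).

Lemma fan_iso_of_action S T (w : point_family (Omega R D I) S)
    (w' : point_family (Omega R D I) T) (a : action_arrow (Omega_act R D I) w w') s :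
  quantum_fan_iso (fan_of D I (calibration_of_point w s))
    (fan_of D I (calibration_of_point w' (action_base a s)))
    (Omega_linear (action_elt a s) (w s)) (Hmx (action_elt a s)).
Proof.
have Ow := pt_in w s.
apply: (iso_Hmx virtI (admissible_sub_rays Ow)).
  exact: (Omega_linear_unit baseD virtI).
by rewrite /= (Omega_actE baseD virtI) // action_eltP.
Qed.

Definition fan_arrow_of_action S T (w : point_family (Omega R D I) S)
    (w' : point_family (Omega R D I) T) (a : action_arrow (Omega_act R D I) w w') :
    fan_arrow (calibration_of_point w) (calibration_of_point w') :=
  FanArrow (smooth_Omega_linear w (@action_elt_locally_constant _ _ _ _ _ _ _ _ _ _ a))
    (locally_constant_map (@Hmx _ D I) (@action_elt_locally_constant _ _ _ _ _ _ _ _ _ _ a))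
    (fan_iso_of_action a).

Definition fan_functor : funover A P.
Proof.
exists (calibration_of_point : forall T, fob A T -> fob P T)
  (fan_arrow_of_action : forall S T (x : fob A S) (y : fob A T), fhom A x y ->
     fhom P (calibration_of_point x) (calibration_of_point y)).
- move=> T w; apply: fan_arrow_eq => //; apply/funext => t /=; last exact: Hmx1.
  apply/esym; apply: (Omega_act_unique baseD virtI (pt_in w t) (w' := w t) _).1.
  by rewrite Hmx1 // intmx1 mul1mx mulmx1.
- move=> S T U x y z b a; apply: fan_arrow_eq => //; apply/funext => t /=; last exact: HmxM.
  apply/esym; apply: (Omega_act_unique baseD virtI (pt_in x t)
    (w' := z (action_base b (action_base a t))) _).1.
  rewrite -mulmxA (Omega_actE baseD virtI); last exact: pt_in.
  rewrite action_eltP mulmxA (Omega_actE baseD virtI); last exact: pt_in.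
  by rewrite action_eltP HmxM // intmxM mulmxA.
- by [].
Defined.

(** An isomorphism (L, H) from h to h' becomes (h'_0^-1 L h_0, H) between the
    normalizations, where h_0 and h'_0 are the blocks of the first d columns. *)
Lemma fan_arrow_normalize S T (h : calibration_family d D I S)
    (h' : calibration_family d D I T) (a : fan_arrow h h') s :
  invmx (lsubmx (h' (fan_base a s))) *m fan_L a s *m lsubmx (h s) =
    Omega_linear (matrix_sym (fan_H a s)) (normalize (h s)) /\
  Omega_act R D I (matrix_sym (fan_H a s)) (normalize (h s)) =
    normalize (h' (fan_base a s)).
Proof.
have ah := cal_admissible h s; have ah' := cal_admissible h' (fan_base a s).
have ai := fan_iso a s; have [_ _ [m0 _ _] _] := ai.
have u := admissible_lsubmx baseD ah; have u' := admissible_lsubmx baseD ah'.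
apply: (Omega_act_unique baseD virtI (normalize_Omega baseD ah)).
rewrite !row_normalize // (matrix_symK ah ah' ai) -!mulmxA mulKVmx //.
by rewrite -(mor_calib m0).
Qed.

Definition action_arrow_of_fan S T (h : calibration_family d D I S)
    (h' : calibration_family d D I T) (a : fan_arrow h h') :
    action_arrow (Omega_act R D I) (point_of_calibration h) (point_of_calibration h') :=
  @ActionArrow _ _ _ _ _ _ _ _ (point_of_calibration h) (point_of_calibration h') _ _
    (locally_constant_map matrix_sym (@fan_H_locally_constant _ _ _ _ _ _ _ _ _ a))
    (fun s => (fan_arrow_normalize a s).2).

Definition point_functor : funover P A.
Proof.
exists (point_of_calibration : forall T, fob P T -> fob A T)
  (action_arrow_of_fan : forall S T (x : fob P S) (y : fob P T), fhom P x y ->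
     fhom A (point_of_calibration x) (point_of_calibration y)).
- move=> T h; apply: action_arrow_eq => //; apply/funext => t /=.
  by rewrite -(Hmx1 virtI) HmxK.
- move=> S T U x y z b a; apply: action_arrow_eq => //; apply/funext => t /=.
  have e1 := matrix_symK (cal_admissible x t) (cal_admissible y _) (fan_iso a t).
  have e2 := matrix_symK (cal_admissible y _) (cal_admissible z _) (fan_iso b (fan_base a t)).
  by rewrite -{1}e1 -{1}e2 -HmxM // HmxK.
- by [].
Defined.

Lemma point_fan_iso : iso_over (compfun_over point_functor fan_functor) (idfun_over A).
Proof.
have Nw T (w : point_family (Omega R D I) T) t :
    point_of_calibration (calibration_of_point w) t = w t.
  exact: normalize_row.
have [_ Oact1 _] := Oact.
have aP T (w : point_family (Omega R D I) T) t :
    Omega_act R D I 1%g (point_of_calibration (calibration_of_point w) t) = w (sid T t).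
  by rewrite Nw Oact1 //; exact: pt_in.
have bP T (w : point_family (Omega R D I) T) t :
    Omega_act R D I 1%g (w t) = point_of_calibration (calibration_of_point w) (sid T t).
  by rewrite Nw Oact1 //; exact: pt_in.
apply: (@iso_over_components _ _ _ (compfun_over point_functor fan_functor) (idfun_over A)
  (fun T w => ActionArrow (@locally_constant_cst _ T _ 1%g) (aP T w))
  (fun T w => ActionArrow (@locally_constant_cst _ T _ 1%g) (bP T w))) => //.
- move=> S T x y f; apply: action_arrow_eq; first exact: smap_eq.
  by apply/funext => s /=; rewrite HmxK mul1g mulg1.
- move=> T w; split; apply: action_arrow_eq; try exact: smap_eq.
    by apply/funext => s /=; rewrite mulg1.
  by apply/funext => s /=; rewrite mulg1.
Qed.

(** With h_0 the block of the first d columns of h, the pair (h_0, 1) is an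
    isomorphism from the normalization of h to h. *)
Lemma fan_point_iso : iso_over (compfun_over fan_functor point_functor) (idfun_over P).
Proof.
have u T (h : calibration_family d D I T) t : lsubmx (h t) \in unitmx.
  exact: (admissible_lsubmx baseD (cal_admissible h t)).
have sL T (h : calibration_family d D I T) : smooth_family (fun t => lsubmx (h t)).
  exact: smooth_family_lsub (@cal_smooth _ _ _ _ _ _ h).
have sV T (h : calibration_family d D I T) : smooth_family (fun t => invmx (lsubmx (h t))).
  exact: smooth_family_invmx (u T h) (sL T h).
have DR T (h : calibration_family d D I T) (t : T) := admissible_sub_rays (cal_admissible h t).
have aP T (h : calibration_family d D I T) t : quantum_fan_iso
    (fan_of D I (calibration_of_point (point_of_calibration h) t))
    (fan_of D I (h (sid T t))) (lsubmx (h t)) 1%:M.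
  rewrite -(Hmx1 virtI); apply: (iso_Hmx virtI (DR T h t)) => //.
  by rewrite /= row_normalize // mulKVmx // Hmx1 // intmx1 mulmx1.
have bP T (h : calibration_family d D I T) t : quantum_fan_iso
    (fan_of D I (h t)) (fan_of D I (calibration_of_point (point_of_calibration h) (sid T t)))
    (invmx (lsubmx (h t))) 1%:M.
  rewrite -(Hmx1 virtI); apply: (iso_Hmx virtI (DR T h t)); first by rewrite unitmx_inv.
  by rewrite /= row_normalize // Hmx1 // intmx1 mulmx1.
apply: (@iso_over_components _ _ _ (compfun_over fan_functor point_functor) (idfun_over P)
  (fun T h => FanArrow (sL T h) (@locally_constant_cst _ T _ 1%:M) (aP T h))
  (fun T h => FanArrow (sV T h) (@locally_constant_cst _ T _ 1%:M) (bP T h))) => //.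
- move=> S T x y a; apply: fan_arrow_eq; first exact: smap_eq.
    apply/funext => s /=; rewrite -(fan_arrow_normalize a s).1.
    by rewrite -!mulmxA mulKVmx.
  apply/funext => s /=; rewrite mulmx1 mul1mx.
  exact: matrix_symK (cal_admissible x s) (cal_admissible y _) (fan_iso a s).
- move=> T h; split; apply: fan_arrow_eq; try exact: smap_eq.
  + by apply/funext => t /=; rewrite mulVmx.
  + by apply/funext => t /=; rewrite mulmx1.
  + by apply/funext => t /=; rewrite mulmxV.
  + by apply/funext => t /=; rewrite mulmx1.
Qed.

End Equivalence.

Theorem theorem2p2p6 (R : realType) (d m : nat)
    (D : {set {set 'I_(d + m)}}) (I : {set 'I_(d + m)})
    (fanD : exists F : quantum_fan R d (d + m),
       [/\ is_quantum_fan F, comb F = D & \rank (lsubmx (qf_calib F)) = d])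
    (coneD : [set lshift m i | i : 'I_d]%SET \in D)
    (virtI : I \subset (~: rays D)%SET) :
  exists Oact : group_action_on (Omega R D I) (Omega_act R D I),
    forall M Q : catover R,
      is_stackification (moduli_prestack R d D I) M ->
      is_stackification (action_prestack Oact) Q ->
      stack_iso M Q.
Proof.
have [F [qF cF rkF]] := fanD.
have baseD (K : {set 'I_(d + m)}) : K \subset [set lshift m i | i : 'I_d]%SET -> K \in D.
  rewrite -cF; apply: sub_simplicial_comb; rewrite ?cF //.
  by rewrite -row_full_unit /row_full rkF.
exists (Omega_act_group baseD virtI) => M Q; apply: stackification_equiv.
  exact: (fan_point_iso baseD virtI).
exact: point_fan_iso.
Qed.
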